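(* Let $\{x^k\}_{k\in\mathbb{N}}$ be the infinite sequence generated by HpgSRN (described in the context) for $\min_{x\in\mathbb{R}^n}F(x)=f(Ax)+\lambda\|x\|_q^q$. Suppose that $\nabla^2 f$ is locally Lipschitz continuous on $\mathbb{R}^m$, that $$\liminf_{\mathcal{K}_2\ni k\to\infty}\frac{-\langle r^k,d^k_{S_k}\rangle}{\|r^k\|\,\|d^k_{S_k}\|}>0,$$ and that $F$ is a KL function. Let $x^*$ be the limit of $\{x^k\}$ (which exists under these hypotheses), $S_*:=\mathrm{supp}(x^* )$, $u^*:=x^*_{S_*}$, and $$\mathcal{U}^*:=\{u\in\mathbb{R}^{|S_*|}\mid \nabla F_{S_*}(u)=0,\ \nabla^2F_{S_*}(u)\succeq0\}.$$ If $\nabla^2F_{S_*}(u^* )\succeq0$ and there exist $\delta>0$ and $\kappa_1>0$ such that for all $u\in\mathbb{B}(u^*,\delta)$ $$\kappa_1\,\mathrm{dist}(u,\mathcal{U}^* )\le\|\nabla F_{S_*}(u)\|,$$ then $\{x^k\}_{k\in\mathbb{N}}$ converges to $x^*$ at a $Q$-superlinear rate of order $1+\sigma$, that is, $\|x^{k+1}-x^*\|=O(\|x^k-x^*\|^{1+\sigma})$ as $k\to\infty$.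
   Context: Problem data. $A\in\mathbb{R}^{m\times n}$; $f:\mathbb{R}^m\to\mathbb{R}$ is twice continuously differentiable with $c_f:=\inf_{z}f(z)>-\infty$; $\lambda>0$; $0<q<1$. Write $\psi(x):=f(Ax)$, $g(x):=\|x\|_q^q=\sum_{i=1}^n|x_i|^q$, $F:=\psi+\lambda g$. For $S\subseteq\{1,\dots,n\}$, $x_S\in\mathbb{R}^{|S|}$ is the subvector of $x$ indexed by $S$, $A_S$ the submatrix of columns of $A$ indexed by $S$, $S^c$ the complement, and $F_S(u):=f(A_Su)+\lambda\sum_{i\in S}|u_i|^q$ for $u\in\mathbb{R}^{|S|}$. $F_S$ is twice continuously differentiable at points with all entries nonzero; derivatives of $F_{S}$ are considered only at such points (so elements of $\mathcal{U}^*$ have all entries nonzero, and $\delta$ is understood small enough that all entries are nonzero on the ball). $\mathbb{B}(u,\delta)$ is the ball of center $u$ and radius $\delta$. $\mathrm{supp}(x):=\{i: x_i\neq0\}$; $\mathrm{sign}(x)$ is taken componentwise; $|x|_{\min}:=\min_{i\in\mathrm{supp}(x)}|x_i|$; $a_+:=\max\{a,0\}$; $\lambda_{\min}(\cdot)$ is the smallest eigenvalue. $\mathrm{prox}_{\mu^{-1}(\lambda g)}(y):=\arg\min_z\{\frac{\mu}{2}\|z-y\|^2+\lambda g(z)\}$ (a set). KL function. $\partial$ denotes the limiting (Mordukhovich) subdifferential. A proper function $h:\mathbb{R}^n\to(-\infty,\infty]$ has the KL property at $\overline{x}\in\mathrm{dom}\,\partial h$ if there are $\eta\in(0,\infty]$,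 a neighborhood $\mathcal{U}$ of $\overline{x}$ and a continuous concave $\varphi:[0,\eta)\to\mathbb{R}_+$ with $\varphi(0)=0$, $\varphi$ continuously differentiable on $(0,\eta)$ with $\varphi'>0$ there, such that $\varphi'(h(x)-h(\overline{x}))\,\mathrm{dist}(0,\partial h(x))\ge1$ for all $x\in\mathcal{U}$ with $h(\overline{x})<h(x)<h(\overline{x})+\eta$. $h$ is a KL function if it has the KL property at every point of $\mathrm{dom}\,\partial h$. Proximal gradient step $\mathcal{G}$. Given $x$, $\mu>0$, $\widetilde\tau>1$, $\widetilde\alpha>0$: for $l=0,1,\dots$ put $\mu_l=\widetilde\tau^{\,l}\mu$ and pick $x^l\in\mathrm{prox}_{\mu_l^{-1}(\lambda g)}(x-\mu_l^{-1}\nabla\psi(x))$; stop at the first $l$ with $F(x^l)\le F(x)-\frac{\widetilde\alpha}{2}\|x^l-x\|^2$ and return $[x^l,\mu_l]$. HpgSRN. Parameters $\widetilde\tau>1$, $\widetilde\alpha>0$, $\mu_{\max}>\mu_{\min}>0$, $\sigma\in(0,\frac12]$, $\varrho\in(0,\frac12)$, $\beta\in(0,1)$, $b_1>1$, $b_2>0$; initial point $x^0\in\mathbb{R}^n$; tolerance $\epsilon=0$. At iteration $k=0,1,2,\dots$: Step 1: choose $\mu_k\in[\mu_{\min},\mu_{\max}]$ and set $[\overline{x}^k,\overline\mu_k]=\mathcal{G}(x^k,\mu_k)$. If $\overline\mu_k\|x^k-\overline{x}^k\|_\infty\le\epsilon$, stop. Let $\overline\omega_k=\overline\mu_k+\lambda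 q(q-1)|\overline{x}^k|_{\min}^{q-2}$. If $\mathrm{sign}(x^k)=\mathrm{sign}(\overline{x}^k)$ and $\overline\mu_k+\lambda q(q-1)|x^k|_{\min}^{q-2}\ge\frac12\overline\omega_k$, go to Step 2; otherwise set $x^{k+1}=\overline{x}^k$ and go to the next iteration. Step 2: let $S_k=\mathrm{supp}(x^k)$, $u^k=x^k_{S_k}$, $r^k=\nabla F_{S_k}(u^k)$, $\zeta_k=[-\lambda_{\min}(\nabla^2F_{S_k}(u^k))]_+$, $G^k=\nabla^2F_{S_k}(u^k)+(b_1\zeta_k+b_2\|r^k\|^\sigma)I$. Let $d^k_{S_k}$ be the solution of $G^kd=-r^k$ and $d^k_{S_k^c}=0$. Let $m_k$ be the smallest nonnegative integer $m$ with $F_{S_k}(u^k+\beta^md^k_{S_k})\le F_{S_k}(u^k)+\varrho\beta^m\langle r^k,d^k_{S_k}\rangle$; set $\alpha_k=\beta^{m_k}$, $x^{k+1}=x^k+\alpha_kd^k$, and go to the next iteration. $\mathcal{K}_1$ is the set of $k$ for which $x^{k+1}$ is generated by Step 1, and $\mathcal{K}_2=\mathbb{N}\setminus\mathcal{K}_1$. Standing assumption: the algorithm does not stop, i.e. $x^k\neq\overline{x}^k$ for all $k$, so the sequence is infinite. (If $\overline{x}^k=0$ the sign condition then fails, so $|0|_{\min}$ is never needed.) *)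

(* Defs.v *)
From HB Require Import structures.
From mathcomp Require Import all_boot all_order all_algebra.
From mathcomp Require Import all_classical all_reals all_analysis.

Set Implicit Arguments.
Unset Strict Implicit.
Unset Printing Implicit Defensive.
Import Order.TTheory GRing.Theory Num.Theory.
Import numFieldNormedType.Exports.

Local Open Scope classical_set_scope.
Local Open Scope ring_scope.

(* The norm `|u| of MathComp-Analysis on matrices is the sup norm, hence the
   separate Euclidean norm [enorm].  The two induce the same topology, so the
   library's convergence and differentiability are the usual ones. *)

Definition dot (R : realType) n (u v : 'cV[R]_n) : R :=
  \sum_i u i 0 * v i 0.

Definition enorm (R : realType) n (u : 'cV[R]_n) : R := Num.sqrt (dot u u).

(* Extended-real valued, so that the distance to the empty set is +oo. *)
Definition dist (R : realType) n (u : 'cV[R]_n) (C : set 'cV[R]_n) : \bar R :=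
  ereal_inf [set (enorm (u - v))%:E | v in C].

(* Gradient and Hessian by partial derivatives; they are the mathematical ones
   wherever the function is (twice) differentiable. *)
Definition grad (R : realType) n (h : 'cV[R]_n -> R) (x : 'cV[R]_n) : 'cV[R]_n :=
  \col_i 'D_(delta_mx i 0) h x.

Definition hess (R : realType) n (h : 'cV[R]_n -> R) (x : 'cV[R]_n) : 'M[R]_n :=
  \matrix_(i, j) 'D_(delta_mx j 0) (fun y => grad h y i 0) x.

Definition twice_continuously_differentiable (R : realType) n
    (h : 'cV[R]_n -> R) : Prop :=
  [/\ forall x, differentiable h x,
      forall x, differentiable (grad h) x
    & continuous (hess h)].

(* Stated with the sup norms; local Lipschitz continuity does not depend on the
   choice of norms. *)
Definition locally_lipschitz (R : realType) m p r
    (h : 'cV[R]_m -> 'M[R]_(p, r)) : Prop :=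
  forall z : 'cV[R]_m, exists2 U, nbhs z U & [lipschitz (h w) | w in U].

Definition psd (R : realType) n (M : 'M[R]_n) : Prop :=
  M^T = M /\ forall v : 'cV[R]_n, 0 <= dot v (M *m v).

(* Smallest eigenvalue of a symmetric matrix of positive order: the set of
   eigenvalues is then finite and nonempty, so [inf] is a minimum. *)
Definition lambda_min (R : realType) n (M : 'M[R]_n) : R :=
  inf [set a : R | eigenvalue M a].

(* Regular (Frechet) subdifferential. *)
Definition regular_subdiff (R : realType) n (h : 'cV[R]_n -> \bar R)
    (x : 'cV[R]_n) : set 'cV[R]_n :=
  [set v | h x \is a fin_num /\
     forall e : R, 0 < e -> \forall y \near x,
       (h x + (dot v (y - x) - e * enorm (y - x))%:E <= h y)%E].

(* Limiting (Mordukhovich) subdifferential. *)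
Definition limiting_subdiff (R : realType) n (h : 'cV[R]_n -> \bar R)
    (x : 'cV[R]_n) : set 'cV[R]_n :=
  [set v | h x \is a fin_num /\
     exists (xs vs : nat -> 'cV[R]_n),
       [/\ xs @ \oo --> x,
           (h \o xs) @ \oo --> h x,
           forall k, regular_subdiff h (xs k) (vs k)
         & vs @ \oo --> v]].

Definition dom_subdiff (R : realType) n (h : 'cV[R]_n -> \bar R)
    : set 'cV[R]_n :=
  [set x | limiting_subdiff h x !=set0].

(* [phi] is a total function; only its values on [0, eta) matter. *)
Definition KL_property (R : realType) n (h : 'cV[R]_n -> \bar R)
    (xb : 'cV[R]_n) : Prop :=
  exists (eta : \bar R) (U : set 'cV[R]_n) (phi : R -> R),
    let I := [set s : R | 0 <= s /\ (s%:E < eta)%E] in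
    [/\ (0 < eta)%E /\ nbhs xb U,
        [/\ forall s, I s -> 0 <= phi s,
            {within I, continuous phi},
            (forall s t a : R, I s -> I t -> 0 <= a <= 1 ->
               a * phi s + (1 - a) * phi t <= phi (a * s + (1 - a) * t))
          & phi 0 = 0],
        forall s : R, 0 < s -> (s%:E < eta)%E ->
          [/\ derivable phi s 1, {for s, continuous (derive1 phi)} & 0 < derive1 phi s]
      & forall x, U x -> (h xb < h x)%E -> (h x < h xb + eta)%E ->
          (1 <= (derive1 phi (fine (h x - h xb)))%:E
                * dist 0 (limiting_subdiff h x))%E].

Definition KL_function (R : realType) n (h : 'cV[R]_n -> \bar R) : Prop :=
  forall xb, dom_subdiff h xb -> KL_property h xb.

Definition supp (R : realType) n (x : 'cV[R]_n) : {set 'I_n} :=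
  [set i | x i 0 != 0]%SET.

(* x_S and A_S: the indices in S are listed in increasing order. *)
Definition subvec (R : realType) n (S : {set 'I_n}) (x : 'cV[R]_n)
    : 'cV[R]_#|S| :=
  \col_i x (enum_val i) 0.

Definition subcols (R : realType) m n (S : {set 'I_n}) (A : 'M[R]_(m, n))
    : 'M[R]_(m, #|S|) :=
  \matrix_(i, j) A i (enum_val j).

(* |x|_min; used for x != 0 only, where [inf] is the minimum of a finite
   nonempty set. *)
Definition absmin (R : realType) n (x : 'cV[R]_n) : R :=
  inf [set `|x i 0| | i in [set i | i \in supp x]].

Definition lqq (R : realType) n (q : R) (x : 'cV[R]_n) : R :=
  \sum_i `|x i 0| `^ q.

Definition psi (R : realType) m n (f : 'cV[R]_m -> R) (A : 'M[R]_(m, n))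
    (x : 'cV[R]_n) : R := f (A *m x).

Definition objF (R : realType) m n (f : 'cV[R]_m -> R) (A : 'M[R]_(m, n))
    (lam q : R) (x : 'cV[R]_n) : R :=
  psi f A x + lam * lqq q x.

Definition objFS (R : realType) m n (f : 'cV[R]_m -> R) (A : 'M[R]_(m, n))
    (lam q : R) (S : {set 'I_n}) : 'cV[R]_#|S| -> R :=
  fun u => f (subcols S A *m u) + lam * lqq q u.
Arguments objFS {R m n} f A lam q S.

(* The set U^* relative to the index set S. *)
Definition second_order_points (R : realType) m n (f : 'cV[R]_m -> R)
    (A : 'M[R]_(m, n)) (lam q : R) (S : {set 'I_n}) : set 'cV[R]_#|S| :=
  [set u : 'cV[R]_#|S| | [/\ forall i, u i 0 != 0,
               grad (objFS f A lam q S) u = 0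
             & psd (hess (objFS f A lam q S) u)]].
Arguments second_order_points {R m n} f A lam q S.

Definition prox (R : realType) n (mu lam q : R) (y : 'cV[R]_n)
    : set 'cV[R]_n :=
  [set z | forall w : 'cV[R]_n,
     mu / 2 * enorm (z - y) ^+ 2 + lam * lqq q z <=
     mu / 2 * enorm (w - y) ^+ 2 + lam * lqq q w].

Record hpg_param (R : realType) := HpgParam {
  hpg_tau : R;
  hpg_alpha : R;
  hpg_mumin : R;
  hpg_mumax : R;
  hpg_sigma : R;
  hpg_rho : R;
  hpg_beta : R;
  hpg_b1 : R;
  hpg_b2 : R }.

Record hpg_param_valid (R : realType) (P : hpg_param R) : Prop := {
  hpg_tau_gt1 : 1 < hpg_tau P;
  hpg_alpha_gt0 : 0 < hpg_alpha P;
  hpg_mumin_gt0 : 0 < hpg_mumin P;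
  hpg_mumin_mumax : hpg_mumin P < hpg_mumax P;
  hpg_sigma_range : 0 < hpg_sigma P <= 2^-1;
  hpg_rho_range : 0 < hpg_rho P < 2^-1;
  hpg_beta_range : 0 < hpg_beta P < 1;
  hpg_b1_gt1 : 1 < hpg_b1 P;
  hpg_b2_gt0 : 0 < hpg_b2 P }.

(* [xb, mub] is a possible output of the procedure G on input (x, mu); the
   procedure is nondeterministic because the proximal mapping is multivalued. *)
Definition prox_grad_step (R : realType) m n (f : 'cV[R]_m -> R)
    (A : 'M[R]_(m, n)) (lam q tau alpha : R) (x : 'cV[R]_n) (mu : R)
    (xb : 'cV[R]_n) (mub : R) : Prop :=
  exists (l : nat) (xs : nat -> 'cV[R]_n),
    let mul j := tau ^+ j * mu in
    let accept z :=
      objF f A lam q z <= objF f A lam q x - alpha / 2 * enorm (z - x) ^+ 2 in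
    [/\ forall j, (j <= l)%N ->
          prox (mul j) lam q (x - (mul j)^-1 *: grad (psi f A) x) (xs j),
        forall j, (j < l)%N -> ~~ accept (xs j),
        accept (xs l)
      & xb = xs l /\ mub = mul l].

Definition newton_test (R : realType) n (lam q : R) (x xb : 'cV[R]_n) (mub : R)
    : Prop :=
  let omega := mub + lam * q * (q - 1) * absmin xb `^ (q - 2) in
  (forall i, Num.sg (x i 0) = Num.sg (xb i 0)) /\
  omega / 2 <= mub + lam * q * (q - 1) * absmin x `^ (q - 2).

(* One regularized Newton step from x to x', with direction d. *)
Definition newton_step (R : realType) m n (f : 'cV[R]_m -> R)
    (A : 'M[R]_(m, n)) (lam q : R) (P : hpg_param R)
    (x d x' : 'cV[R]_n) : Prop :=
  let S := supp x in
  let FS := objFS f A lam q S in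
  let u := subvec S x in
  let dS := subvec S d in
  let r := grad FS u in
  let zeta := Num.max (- lambda_min (hess FS u)) 0 in
  let G := hess FS u
           + (hpg_b1 P * zeta + hpg_b2 P * enorm r `^ hpg_sigma P)%:M in
  let armijo j :=
    FS (u + hpg_beta P ^+ j *: dS) <=
    FS u + hpg_rho P * hpg_beta P ^+ j * dot r dS in
  [/\ G *m dS = - r,
      forall i, i \notin S -> d i 0 = 0
    & exists mk : nat,
        [/\ armijo mk,
            forall j, (j < mk)%N -> ~~ armijo j
          & x' = x + hpg_beta P ^+ mk *: d]].

Definition K2 (R : realType) n (lam q : R) (x xb : nat -> 'cV[R]_n)
    (mub : nat -> R) : set nat :=
  [set k | newton_test lam q (x k) (xb k) (mub k)].

(* The algorithm with tolerance 0 produces the infinite run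
   x = (x^k), xb = (\overline x^k), mu = (mu_k), mub = (\overline mu_k); d k is
   the Newton direction d^k when k is in K2, and is unconstrained otherwise. *)
Record HpgSRN (R : realType) m n (f : 'cV[R]_m -> R) (A : 'M[R]_(m, n))
    (lam q : R) (P : hpg_param R) (x xb d : nat -> 'cV[R]_n)
    (mu mub : nat -> R) : Prop := {
  hpg_mu : forall k, hpg_mumin P <= mu k <= hpg_mumax P;
  hpg_prox : forall k, prox_grad_step f A lam q (hpg_tau P) (hpg_alpha P)
                         (x k) (mu k) (xb k) (mub k);
  hpg_no_stop : forall k, x k <> xb k;
  hpg_step1 : forall k, ~ K2 lam q x xb mub k -> x k.+1 = xb k;
  hpg_step2 : forall k, K2 lam q x xb mub k ->
                newton_step f A lam q P (x k) (d k) (x k.+1) }.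

(* -<r^k, d^k_{S_k}> / (||r^k|| ||d^k_{S_k}||) at x = x^k, d = d^k. *)
Definition descent_ratio (R : realType) m n (f : 'cV[R]_m -> R)
    (A : 'M[R]_(m, n)) (lam q : R) (x d : 'cV[R]_n) : R :=
  let S := supp x in
  let r := grad (objFS f A lam q S) (subvec S x) in
  let dS := subvec S d in
  - dot r dS / (enorm r * enorm dS).

(* Main.v *)
Require Import Defs.
From HB Require Import structures.
From mathcomp Require Import all_boot all_order all_algebra.
From mathcomp Require Import all_classical all_reals all_analysis.
From mathcomp Require Import ring lra.
Set Implicit Arguments.
Unset Strict Implicit.
Unset Printing Implicit Defensive.
Import Order.TTheory GRing.Theory Num.Theory.
Import numFieldNormedType.Exports.
Local Open Scope classical_set_scope.
Local Open Scope ring_scope.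

(* The prox step leaves only entries bounded away from zero, the Newton test
   transfers that bound to the Newton iterates, and successive differences tend to
   zero; so the supports S and signs of the iterates are eventually constant.  On
   that region F is the smooth function F_S, both kinds of steps satisfy
   F(x^k) - F(x^(k+1)) >= c |x^(k+1) - x^k| |grad F_S|, and since the zero extension
   of grad F_S is a subgradient of F, the KL inequality bounds the lengths of the
   steps by a telescoping sum.  At the limit, global optimality in the prox problem,
   compared with the value at 0, gives the Newton test slack, so that all late steps
   are Newton steps.  With r^k = grad F_S(u^k), the error bound supplies a
   second-order point v with |u^k - v| = O(|r^k|); hence zeta_k = O(|r^k|) and
   |d^k| = O(|r^k|), the unit step is accepted, and Taylor's formula gives
   |r^(k+1)| = O(|r^k|^(1+sigma)).  Summing the steps, |u^k - u*| = O(|r^k|), which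
   together with r^k = O(|u^k - u*|) is the rate. *)

(** * Euclidean norm and smallest eigenvalue *)

Section Euclidean.
Context {R : realType}.

Lemma dotE n (u v : 'cV[R]_n) : dot u v = (u^T *m v) 0 0.
Proof. by rewrite mxE; apply: eq_bigr => i _; rewrite mxE. Qed.

Lemma dotC n (u v : 'cV[R]_n) : dot u v = dot v u.
Proof. by apply: eq_bigr => i _; rewrite mulrC. Qed.

Lemma dotDl n (u v w : 'cV[R]_n) : dot (u + v) w = dot u w + dot v w.
Proof. by rewrite !dotE linearD mulmxDl mxE. Qed.

Lemma dotDr n (u v w : 'cV[R]_n) : dot w (u + v) = dot w u + dot w v.
Proof. by rewrite !dotE mulmxDr mxE. Qed.

Lemma dotZl n a (u v : 'cV[R]_n) : dot (a *: u) v = a * dot u v.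
Proof. by rewrite !dotE linearZ -scalemxAl mxE. Qed.

Lemma dotZr n a (u v : 'cV[R]_n) : dot u (a *: v) = a * dot u v.
Proof. by rewrite dotC dotZl dotC. Qed.

Lemma dotNl n (u v : 'cV[R]_n) : dot (- u) v = - dot u v.
Proof. by rewrite -scaleN1r dotZl mulN1r. Qed.

Lemma dotNr n (u v : 'cV[R]_n) : dot u (- v) = - dot u v.
Proof. by rewrite dotC dotNl dotC. Qed.

Lemma dotBl n (u v w : 'cV[R]_n) : dot (u - v) w = dot u w - dot v w.
Proof. by rewrite dotDl dotNl. Qed.

Lemma dotBr n (u v w : 'cV[R]_n) : dot w (u - v) = dot w u - dot w v.
Proof. by rewrite dotDr dotNr. Qed.

Lemma dot0v n (v : 'cV[R]_n) : dot 0 v = 0.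
Proof. by rewrite -[0](scale0r v) dotZl mul0r. Qed.

Lemma dot_mulmxr m n (M : 'M[R]_(m, n)) u v :
  dot u (M *m v) = dot (M^T *m u) v.
Proof. by rewrite !dotE trmx_mul trmxK mulmxA. Qed.

Lemma dot_delta n (u : 'cV[R]_n) i : dot u (delta_mx i 0) = u i 0.
Proof.
rewrite /dot (bigD1 i)//= !mxE !eqxx mulr1 big1 ?addr0// => j ji.
by rewrite !mxE (negbTE ji) mulr0.
Qed.

Lemma dot_ge0 n (u : 'cV[R]_n) : 0 <= dot u u.
Proof. by apply: sumr_ge0 => i _; rewrite -expr2 sqr_ge0. Qed.

Lemma sqr_coord_le_dot n (u : 'cV[R]_n) i : u i 0 ^+ 2 <= dot u u.
Proof.
rewrite /dot (bigD1 i)//= -expr2 lerDl; apply: sumr_ge0 => j _.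
by rewrite -expr2 sqr_ge0.
Qed.

Lemma discriminant_le (a b c : R) : 0 <= c ->
  (forall t, 0 <= a + 2 * t * b + t ^+ 2 * c) -> b ^+ 2 <= a * c.
Proof.
rewrite le_eqVlt => /predU1P[<- h|c0 h].
  have [->|b0] := eqVneq b 0; first by rewrite expr0n mulr0.
  have := h (- (a + 1) / (2 * b)).
  suff -> : a + 2 * (- (a + 1) / (2 * b)) * b + (- (a + 1) / (2 * b)) ^+ 2 * 0
            = -1 by rewrite ler0N1.
  by field.
have := h (- b / c).
rewrite (_ : a + _ + _ = a - b ^+ 2 / c); last by field; rewrite gt_eqF.
by rewrite subr_ge0 ler_pdivrMr.
Qed.

Lemma psd_cauchy_schwarz n (M : 'M[R]_n) u v : psd M ->
  dot u (M *m v) ^+ 2 <= dot u (M *m u) * dot v (M *m v).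
Proof.
move=> [Msym Mpos]; apply: discriminant_le => [//|t].
have := Mpos (u + t *: v).
rewrite mulmxDr -scalemxAr !(dotDl, dotDr, dotZl, dotZr).
rewrite (_ : dot v (M *m u) = dot u (M *m v)); last first.
  by rewrite dot_mulmxr Msym dotC.
suff -> : forall a b c : R, a + t * b + t * (b + t * c) = a + 2 * t * b + t ^+ 2 * c by [].
by move=> a b c; ring.
Qed.

Lemma psd1 n : psd (1%:M : 'M[R]_n).
Proof. by split; [rewrite trmx1|move=> v; rewrite mul1mx dot_ge0]. Qed.

Lemma enorm_ge0 n (u : 'cV[R]_n) : 0 <= enorm u.
Proof. exact: sqrtr_ge0. Qed.

Lemma sqr_enorm n (u : 'cV[R]_n) : enorm u ^+ 2 = dot u u.
Proof. by rewrite sqr_sqrtr// dot_ge0. Qed.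

Lemma enorm0 n : enorm (0 : 'cV[R]_n) = 0.
Proof. by rewrite /enorm dot0v sqrtr0. Qed.

Lemma enormZ n a (u : 'cV[R]_n) : enorm (a *: u) = `|a| * enorm u.
Proof.
by rewrite /enorm dotZl dotZr mulrA -expr2 sqrtrM ?sqr_ge0// sqrtr_sqr.
Qed.

Lemma enormN n (u : 'cV[R]_n) : enorm (- u) = enorm u.
Proof. by rewrite /enorm dotNl dotNr opprK. Qed.

Lemma enorm_distC n (u v : 'cV[R]_n) : enorm (u - v) = enorm (v - u).
Proof. by rewrite -enormN opprB. Qed.

Lemma cauchy_schwarz n (u v : 'cV[R]_n) : `|dot u v| <= enorm u * enorm v.
Proof.
rewrite -(@ler_pXn2r _ 2)// ?nnegrE ?mulr_ge0 ?enorm_ge0//.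
rewrite real_normK ?num_real// exprMn !sqr_enorm.
by have := psd_cauchy_schwarz u v (@psd1 n); rewrite !mul1mx.
Qed.

Lemma dot_le_enorm n (u v : 'cV[R]_n) : dot u v <= enorm u * enorm v.
Proof. exact: le_trans (ler_norm _) (cauchy_schwarz u v). Qed.

Lemma ler_enormD n (u v : 'cV[R]_n) : enorm (u + v) <= enorm u + enorm v.
Proof.
rewrite -(@ler_pXn2r _ 2)// ?nnegrE ?addr_ge0 ?enorm_ge0//.
rewrite sqrrD !sqr_enorm dotDl !dotDr (dotC v u).
have := dot_le_enorm u v; lra.
Qed.

Lemma ler_enormB n (u v : 'cV[R]_n) : enorm (u - v) <= enorm u + enorm v.
Proof. by rewrite -(enormN v) ler_enormD. Qed.

Lemma ler_enorm_dist n (w u v : 'cV[R]_n) :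
  enorm (u - v) <= enorm (u - w) + enorm (w - v).
Proof. by rewrite -(subrKA w) ler_enormD. Qed.

Lemma coord_le_enorm n (u : 'cV[R]_n) i : `|u i 0| <= enorm u.
Proof.
rewrite -(@ler_pXn2r _ 2)// ?nnegrE ?enorm_ge0//.
by rewrite real_normK ?num_real// sqr_enorm sqr_coord_le_dot.
Qed.

Lemma enorm_eq0 n (u : 'cV[R]_n) : (enorm u == 0) = (u == 0).
Proof.
apply/eqP/eqP => [u0|->]; last exact: enorm0.
apply/matrixP => i j; rewrite ord1 mxE; apply/eqP.
by rewrite -normr_le0 -u0 coord_le_enorm.
Qed.

Lemma enorm_gt0 n (u : 'cV[R]_n) : (0 < enorm u) = (u != 0).
Proof. by rewrite lt_def enorm_ge0 andbT enorm_eq0. Qed.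

Lemma enorm_le_sum n (u : 'cV[R]_n) : enorm u <= \sum_i `|u i 0|.
Proof.
have s0 : 0 <= \sum_i `|u i 0| by apply: sumr_ge0 => i _.
rewrite -(@ler_pXn2r _ 2)// ?nnegrE ?enorm_ge0// sqr_enorm expr2 mulr_suml.
apply: ler_sum => i _; apply: le_trans (ler_norm _) _.
rewrite normrM ler_wpM2l// (bigD1 i)//= lerDl.
by apply: sumr_ge0 => j _.
Qed.

Definition mxsum m n (M : 'M[R]_(m, n)) : R := \sum_i \sum_j `|M i j|.

Lemma mxsum_ge0 m n (M : 'M[R]_(m, n)) : 0 <= mxsum M.
Proof. by apply: sumr_ge0 => i _; apply: sumr_ge0. Qed.

Lemma enorm_mulmx m n (M : 'M[R]_(m, n)) v :
  enorm (M *m v) <= mxsum M * enorm v.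
Proof.
apply: le_trans (enorm_le_sum _) _; rewrite mulr_suml.
apply: ler_sum => i _; rewrite mxE mulr_suml.
apply: le_trans (ler_norm_sum _ _ _) _; apply: ler_sum => j _.
by rewrite normrM ler_wpM2l// coord_le_enorm.
Qed.

Lemma coord_le_mx_norm m n (M : 'M[R]_(m, n)) i j : `|M i j| <= `|M|.
Proof.
rewrite [leRHS]/Num.norm/= mx_normrE.
by apply/bigmax_geP; right; exists (i, j).
Qed.

Lemma mxsum_le_norm m n (M : 'M[R]_(m, n)) : mxsum M <= (m * n)%:R * `|M|.
Proof.
apply: (@le_trans _ _ (\sum_(i < m) \sum_(j < n) `|M|)).
  by apply: ler_sum => i _; apply: ler_sum => j _; exact: coord_le_mx_norm.
by rewrite !sumr_const !card_ord -mulrnA mulnC mulr_natl.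
Qed.

Lemma norm_le_enorm n (u : 'cV[R]_n) : `|u| <= enorm u.
Proof.
rewrite [leLHS]/Num.norm/= mx_normrE; apply/bigmax_leP; split=> [|[i j] _ /=].
  exact: enorm_ge0.
by rewrite ord1 coord_le_enorm.
Qed.

Lemma enorm_le_norm n (u : 'cV[R]_n) : enorm u <= n%:R * `|u|.
Proof.
apply: le_trans (enorm_le_sum _) _.
apply: (@le_trans _ _ (\sum_(i < n) `|u|)).
  by apply: ler_sum => i _; exact: coord_le_mx_norm.
by rewrite sumr_const card_ord mulr_natl.
Qed.

End Euclidean.

Section Rayleigh.
Context {R : realType}.

Lemma psd_inv_coercive n (M : 'M[R]_n) : psd M -> M \in unitmx ->
  exists2 c, 0 < c & forall v, c * dot v v <= dot v (M *m v).
Proof.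
move=> Mpsd Minv; exists (mxsum (invmx M) + 1)^-1.
  by rewrite invr_gt0 ltr_wpDl// mxsum_ge0.
move=> v; have c0 : 0 < mxsum (invmx M) + 1 by rewrite ltr_wpDl// mxsum_ge0.
rewrite ler_pdivrMl//.
have [->|v0] := eqVneq v 0; first by rewrite mulmx0 !dot0v mulr0.
have vv0 : 0 < dot v v by rewrite -sqr_enorm exprn_gt0// enorm_gt0.
have := psd_cauchy_schwarz v (invmx M *m v) Mpsd.
rewrite mulmxA mulmxV// mul1mx expr2 => h.
have h2 : dot (invmx M *m v) v <= (mxsum (invmx M) + 1) * dot v v.
  apply: le_trans (dot_le_enorm _ _) _.
  rewrite -sqr_enorm expr2 mulrA ler_wpM2r ?enorm_ge0//.
  apply: le_trans (enorm_mulmx _ _) _; rewrite ler_wpM2r ?enorm_ge0//.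
  by rewrite lerDl.
rewrite -(ler_pM2r vv0); apply: le_trans h _.
rewrite [leRHS]mulrAC [leRHS]mulrC; apply: ler_wpM2l => //.
by case: Mpsd => _; exact.
Qed.

Lemma sub_scalar_mulmx n (M : 'M[R]_n) a (v : 'cV[R]_n) :
  (M - a%:M) *m v = M *m v - a *: v.
Proof. by rewrite mulmxBl mul_scalar_mx. Qed.

(* The supremum a of the c with M - c I psd is an eigenvalue: otherwise M - a I
   would be invertible and psd, hence coercive, and a could be increased. *)
Lemma ex_min_eigenvalue n (M : 'M[R]_n.+1) : M^T = M ->
  exists2 a, eigenvalue M a & forall v, a * dot v v <= dot v (M *m v).
Proof.
move=> Msym.
pose C := [set c : R | forall v, c * dot v v <= dot v (M *m v)].
have C0 : C (- mxsum M).
  move=> v; rewrite mulNr lerNl -dotNl -sqr_enorm expr2 mulrA.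
  apply: le_trans (dot_le_enorm _ _) _; rewrite enormN mulrC.
  by rewrite ler_wpM2r ?enorm_ge0// enorm_mulmx.
have Cub : ubound C (M 0 0).
  move=> c /(_ (delta_mx 0 0)); rewrite !dot_delta mxE !eqxx mulr1.
  by rewrite dotC dot_delta mxE (bigD1 0)//= !mxE !eqxx mulr1 big1
    ?addr0// => j j0; rewrite !mxE (negbTE j0) mulr0.
have Csup : has_sup C by split; [exists (- mxsum M)|exists (M 0 0)].
have Ca : C (sup C).
  move=> v; have [->|v0] := eqVneq v 0; first by rewrite mulmx0 !dot0v mulr0.
  have vv0 : 0 < dot v v by rewrite -sqr_enorm exprn_gt0// enorm_gt0.
  rewrite -ler_pdivlMr//; apply: ge_sup => [|c Cc].
    by exists (- mxsum M).
  by rewrite ler_pdivlMr.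
have Npsd : psd (M - (sup C)%:M).
  split=> [|v]; first by rewrite linearB/= Msym tr_scalar_mx.
  by rewrite sub_scalar_mulmx dotBr dotZr subr_ge0.
exists (sup C); last exact: Ca.
rewrite /eigenvalue; apply/negP => /eqP.
rewrite /eigenspace => /eqP; rewrite kermx_eq0 row_free_unit.
move=> /(psd_inv_coercive Npsd)[c c0 hc].
have : C (sup C + c).
  move=> v; have := hc v; rewrite sub_scalar_mulmx dotBr dotZr; lra.
move=> /(sup_upper_bound Csup); lra.
Qed.

Lemma eigenvalue_quadform n (M : 'M[R]_n) a : M^T = M -> eigenvalue M a ->
  exists2 v : 'cV[R]_n, v != 0 & dot v (M *m v) = a * dot v v.
Proof.
move=> Msym /eigenvalueP[v vM v0]; exists v^T; first by rewrite trmx_eq0.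
by rewrite -[M]Msym -trmx_mul vM linearZ dotZr.
Qed.

Lemma rayleigh n (M : 'M[R]_n) v : M^T = M ->
  lambda_min M * dot v v <= dot v (M *m v).
Proof.
case: n M v => [|n] M v Msym.
  by rewrite [v]flatmx0 mulmx0 dot0v mulr0.
have [a Ma ha] := ex_min_eigenvalue Msym.
apply: le_trans (ha v); rewrite ler_wpM2r ?dot_ge0// ge_inf//.
exists a => b /(eigenvalue_quadform Msym)[w w0 hw].
by rewrite -(@ler_pM2r _ (dot w w)) -?hw// -sqr_enorm exprn_gt0// enorm_gt0.
Qed.

Lemma lambda_min_ge n (M : 'M[R]_n) c : M^T = M -> c <= 0 ->
  (forall v, c * dot v v <= dot v (M *m v)) -> c <= lambda_min M.
Proof.
move=> Msym c0 hc; rewrite /lambda_min.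
have [->|/set0P E0] := eqVneq [set a | eigenvalue M a] set0.
  by rewrite inf0.
apply: lb_le_inf => // b /(eigenvalue_quadform Msym)[w w0 hw].
by rewrite -(@ler_pM2r _ (dot w w)) -?hw// -sqr_enorm exprn_gt0// enorm_gt0.
Qed.

End Rayleigh.

(** * Taylor estimates *)

Section Taylor.
Context {R : realType}.

Lemma is_derive_line (U V W : normedModType R) (f : U -> W) (g : V -> W)
    x v y w (df : W) : (forall h, f (h *: v + x) = g (h *: w + y)) ->
  is_derive x v f df -> is_derive y w g df.
Proof.
move=> fg [fd fE].
have E : (fun h : R => h^-1 *: ((f \o shift x) (h *: v) - f x)) =
         (fun h : R => h^-1 *: ((g \o shift y) (h *: w) - g y)).
  apply/funext => h /=; rewrite fg.
  by have := fg 0; rewrite !scale0r !add0r => ->.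
by split; [rewrite /derivable -E|rewrite -fE /derive -E].
Qed.

Lemma is_derive_segment n (h : 'cV[R]_n -> R) u p t dh :
  is_derive (u + t *: p) p h dh -> is_derive t 1 (fun s : R => h (u + s *: p)) dh.
Proof.
apply: is_derive_line => s; congr h.
by rewrite scalerDl addrCA; congr (_ + (_ + _)); rewrite /GRing.scale/= mulr1.
Qed.

Lemma is_derive_dot m n (e : 'cV[R]_n) (G : 'cV[R]_m -> 'cV[R]_n) u v (dG : 'cV[R]_n) :
  (forall i, is_derive u v (fun y => G y i 0) (dG i 0)) ->
  is_derive u v (fun y => dot e (G y)) (dot e dG).
Proof.
move=> hG; rewrite /dot.
have -> : (fun y => \sum_i e i 0 * G y i 0) =
    \sum_(i < n) (e i 0 *: (fun y => G y i 0)).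
  by apply/funext => y; rewrite fct_sumE.
exact: is_derive_sum.
Qed.

Lemma mean_value01 (phi dphi : R -> R) :
  (forall t : R, 0 <= t <= 1 -> is_derive t 1 phi (dphi t)) ->
  exists2 t, 0 <= t <= 1 & phi 1 - phi 0 = dphi t.
Proof.
move=> hd.
have [t||t t01 E] := @MVT_segment R phi dphi 0 1 ler01.
- by rewrite in_itv/= => /andP[t0 t1]; apply: hd; rewrite !ltW.
- by apply: derivable_within_continuous => t; rewrite in_itv/= => /hd[].
by exists t; [rewrite in_itv/= in t01|rewrite E subr0 mulr1].
Qed.

Lemma is_derive_mulr (c t : R) : is_derive t 1 (fun s : R => s * c) c.
Proof.
have -> : (fun s : R => s * c) = c *: id.
  by apply/funext => s; rewrite mulrC.
by apply: is_derive_eq; rewrite /GRing.scale/= mulr1.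
Qed.

Lemma is_derive_sqr_mulr (c t : R) :
  is_derive t 1 (fun s : R => s ^+ 2 * c) (2 * t * c).
Proof.
have -> : (fun s : R => s ^+ 2 * c) = c *: (id ^+ 2).
  by apply/funext => s; rewrite mulrC.
by apply: is_derive_eq; rewrite /GRing.scale/= expr1; ring.
Qed.

Definition segment_closed n (B : set 'cV[R]_n) := forall u w (t : R),
  B u -> B w -> 0 <= t <= 1 -> B (u + t *: (w - u)).

Lemma enorm_ball_segment n (u0 : 'cV[R]_n) rho :
  segment_closed [set u | enorm (u - u0) <= rho].
Proof.
move=> u w t /= hu hw /andP[t0 t1].
have -> : u + t *: (w - u) - u0 = (1 - t) *: (u - u0) + t *: (w - u0).
  apply/matrixP => i j; rewrite !mxE; ring.
apply: le_trans (ler_enormD _ _) _; rewrite !enormZ !ger0_norm ?subr_ge0//.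
have : (1 - t) * enorm (u - u0) <= (1 - t) * rho by rewrite ler_wpM2l ?subr_ge0.
have : t * enorm (w - u0) <= t * rho by rewrite ler_wpM2l.
lra.
Qed.

Variables (n : nat) (B : set 'cV[R]_n) (h : 'cV[R]_n -> R).
Variables (G : 'cV[R]_n -> 'cV[R]_n) (H : 'cV[R]_n -> 'M[R]_n).
Hypothesis Bseg : segment_closed B.
Hypothesis dh : forall u v, B u -> is_derive u v h (dot (G u) v).
Hypothesis dG : forall u v i, B u ->
  is_derive u v (fun y => G y i 0) ((H u *m v) i 0).

Lemma mean_value_gradient u w e : B u -> B w ->
  exists2 z, B z & enorm (z - u) <= enorm (w - u) /\
    dot e (G w - G u) = dot e (H z *m (w - u)).
Proof.
move=> Bu Bw.
have [t t01 E] := @mean_value01 (fun s => dot e (G (u + s *: (w - u))))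
  (fun s => dot e (H (u + s *: (w - u)) *m (w - u))) (fun t t01 =>
  is_derive_segment (is_derive_dot e (fun i => dG (w - u) i (Bseg Bu Bw t01)))).
exists (u + t *: (w - u)); first exact: Bseg.
split.
  rewrite addrC addKr enormZ ler_piMl ?enorm_ge0//.
  by case/andP: t01 => t0 t1; rewrite ger0_norm.
by rewrite -E scale1r scale0r addr0 subrKC dotBr.
Qed.

Lemma gradient_lipschitz M u w : B u -> B w -> 0 <= M ->
  (forall z v, B z -> enorm (H z *m v) <= M * enorm v) ->
  enorm (G w - G u) <= M * enorm (w - u).
Proof.
move=> Bu Bw M0 HM; set e := G w - G u.
have [->|e0] := eqVneq e 0; first by rewrite enorm0 mulr_ge0// enorm_ge0.
have [z Bz [_ E]] := mean_value_gradient e Bu Bw.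
rewrite -(@ler_pM2l _ (enorm e)) ?enorm_gt0// -expr2 sqr_enorm E.
apply: le_trans (dot_le_enorm _ _) _.
by rewrite ler_wpM2l ?enorm_ge0// HM.
Qed.

Lemma taylor1 M u w : B u -> B w -> 0 <= M ->
  (forall z v, B z -> enorm (H z *m v) <= M * enorm v) ->
  `|h w - h u - dot (G u) (w - u)| <= M * enorm (w - u) ^+ 2.
Proof.
move=> Bu Bw M0 HM; set p := w - u.
have [t t01|t t01 E] := @mean_value01
  (fun s => h (u + s *: p) - s * dot (G u) p)
  (fun s => dot (G (u + s *: p) - G u) p).
  rewrite dotBl; apply: is_deriveB.
    exact/is_derive_segment/dh/Bseg.
  exact: is_derive_mulr.
have -> : h w - h u - dot (G u) p = dot (G (u + t *: p) - G u) p.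
  by rewrite -E scale1r scale0r addr0 subrKC; ring.
apply: le_trans (cauchy_schwarz _ _) _.
rewrite expr2 mulrA ler_wpM2r ?enorm_ge0//.
apply: le_trans (gradient_lipschitz Bu (Bseg Bu Bw t01) M0 HM) _.
rewrite ler_wpM2l// addrC addKr enormZ ler_piMl ?enorm_ge0//.
by case/andP: t01 => t0 t1; rewrite ger0_norm.
Qed.

Variable L : R.
Hypothesis L0 : 0 <= L.
Hypothesis HL : forall u w v, B u -> B w ->
  enorm ((H u - H w) *m v) <= L * enorm (u - w) * enorm v.

Lemma taylor_gradient u w : B u -> B w ->
  enorm (G w - G u - H u *m (w - u)) <= L * enorm (w - u) ^+ 2.
Proof.
move=> Bu Bw; set e := _ - _ *m _.
have [->|e0] := eqVneq e 0.
  by rewrite enorm0 mulr_ge0// exprn_ge0// enorm_ge0.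
have [z Bz [zu E]] := mean_value_gradient e Bu Bw.
rewrite -(@ler_pM2l _ (enorm e)) ?enorm_gt0// -expr2 (sqr_enorm e).
have -> : dot e e = dot e ((H z - H u) *m (w - u)).
  by rewrite {2}/e dotBr E -dotBr -mulmxBl.
apply: le_trans (dot_le_enorm _ _) _.
rewrite ler_wpM2l ?enorm_ge0//; apply: le_trans (HL _ Bz Bu) _.
by rewrite expr2 mulrA ler_wpM2r ?enorm_ge0// ler_wpM2l.
Qed.

Lemma taylor2 u w : B u -> B w ->
  `|h w - h u - dot (G u) (w - u) - dot (w - u) (H u *m (w - u)) / 2|
    <= L * enorm (w - u) ^+ 3.
Proof.
move=> Bu Bw; set p := w - u.
have [t t01|t t01 E] := @mean_value01
  (fun s => h (u + s *: p) - s * dot (G u) p - s ^+ 2 * (dot p (H u *m p) / 2))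
  (fun s => dot (G (u + s *: p) - G u - H u *m (s *: p)) p).
  rewrite [X in is_derive _ _ _ X]dotBl [X in is_derive _ _ _ (X - _)]dotBl.
  apply: is_deriveB; first apply: is_deriveB.
  - exact/is_derive_segment/dh/Bseg.
  - exact: is_derive_mulr.
  - rewrite -scalemxAr dotZl (dotC p).
    by apply: (is_derive_eq (is_derive_sqr_mulr _ _)); field.
have -> : h w - h u - dot (G u) p - dot p (H u *m p) / 2 =
    dot (G (u + t *: p) - G u - H u *m (t *: p)) p.
  by rewrite -E scale1r scale0r addr0 subrKC expr0n/=; ring.
apply: le_trans (cauchy_schwarz _ _) _.
rewrite exprSr mulrA ler_wpM2r ?enorm_ge0//.
have tp : u + t *: p - u = t *: p by rewrite addrC addKr.
have := taylor_gradient Bu (Bseg Bu Bw t01); rewrite tp => /le_trans; apply.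
rewrite ler_wpM2l// ler_sqr ?nnegrE ?enorm_ge0// enormZ.
rewrite ler_piMl ?enorm_ge0//.
by case/andP: t01 => t0 t1; rewrite ger0_norm.
Qed.

End Taylor.

Section ColumnTopology.
Context {R : realType}.

Lemma near_enormP n (x : 'cV[R]_n) (P : set 'cV[R]_n) :
  (\forall y \near x, P y) <->
  exists2 e : R, 0 < e & forall y, enorm (y - x) < e -> P y.
Proof.
split.
  move=> /nbhs_ballP[e /= e0 xeP]; exists e => // y yx; apply: xeP.
  rewrite -ball_normE/= distrC; exact: le_lt_trans (norm_le_enorm _) yx.
move=> [e e0 eP]; apply/nbhs_ballP; exists (e / n.+1%:R) => /=.
  by rewrite divr_gt0.
move=> y; rewrite -ball_normE/= distrC ltr_pdivlMr// => yx; apply: eP.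
apply: le_lt_trans (enorm_le_norm _) _; apply: le_lt_trans yx.
by rewrite mulrC ler_wpM2l// ler_nat.
Qed.

Lemma continuous_enormP n (W : normedModType R) (f : 'cV[R]_n -> W) x :
  {for x, continuous f} <->
  forall e : R, 0 < e ->
    exists2 d : R, 0 < d & forall y, enorm (y - x) < d -> `|f y - f x| < e.
Proof.
split=> [/cvgrPdist_lt cf e e0|cf].
  have /near_enormP[d d0 dP] := cf _ e0.
  by exists d => // y /dP; rewrite distrC.
apply/(@cvgrPdist_lt _ _ _ (nbhs x)) => e /cf[d d0 dP]; apply/near_enormP; exists d => // y /dP.
by rewrite distrC.
Qed.

Lemma cvg_enormP n (x : nat -> 'cV[R]_n) (l : 'cV[R]_n) :
  x @ \oo --> l <->
  forall e : R, 0 < e -> \forall k \near \oo, enorm (x k - l) < e.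
Proof.
split=> [xl e e0|h].
  by apply: (xl [set y | enorm (y - l) < e]); apply/near_enormP; exists e.
apply/(@cvgrPdist_lt _ _ _ (x @ \oo)) => e /h; apply: filterS => k hk.
by rewrite /= distrC; exact: le_lt_trans (norm_le_enorm _) hk.
Qed.

Lemma enorm_ball_compact n (r : R) : compact [set u : 'cV[R]_n | enorm u <= r].
Proof.
pose K := [set v : 'rV[R]_n | enorm v^T <= r].
have -> : [set u : 'cV[R]_n | enorm u <= r] = trmx @` K.
  apply/seteqP; split=> [u ur|_ [v vr <-]//].
  by exists u^T; rewrite /K/= trmxK.
have ctr : continuous (trmx : 'rV[R]_n -> 'cV[R]_n).
  move=> v; apply/(@cvgrPdist_lt _ _ _ (nbhs v)) => e e0; near=> w.
  rewrite -linearB/=; apply: le_lt_trans (_ : `|v - w| < e).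
    rewrite [leLHS]/Num.norm/= mx_normrE; apply/bigmax_leP; split=> // -[i j] _.
    by rewrite mxE; exact: coord_le_mx_norm.
  by near: w; apply/nbhs_ballP; exists e => //= w; rewrite -ball_normE.
apply: continuous_compact; first exact: continuous_subspaceT.
apply: bounded_closed_compact.
  exists r; split; first exact: num_real.
  move=> M rM v /= vr; apply: le_trans (ltW rM); apply: le_trans vr.
  rewrite [leLHS]/Num.norm/= mx_normrE; apply/bigmax_leP.
  split=> [|[i j] _ /=]; first exact: enorm_ge0.
  by rewrite ord1 -[v in leLHS]trmxK mxE; exact: coord_le_enorm.
rewrite -openC openE => v /= /negP; rewrite -ltNge => rv.
have : \forall u \near v^T, r < enorm u.
  apply/near_enormP; exists (enorm v^T - r); first by rewrite subr_gt0.
  move=> y yv; have := ler_enormD (v^T - y) y; rewrite subrK enorm_distC; lra.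
move=> /(ctr v) hv; apply: (@filterS _ (nbhs v) _ _ _ _ hv) => w /= rw.
by apply/negP; rewrite -ltNge.
Unshelve. all: by end_near. Qed.

Lemma enorm_ball_bounded n (W : normedModType R) (f : 'cV[R]_n -> W) r :
  continuous f -> exists2 M : R, 0 <= M & forall u, enorm u <= r -> `|f u| <= M.
Proof.
move=> cf; have : bounded_set (f @` [set u : 'cV[R]_n | enorm u <= r]).
  apply: compact_bounded; apply: continuous_compact.
    exact: continuous_subspaceT.
  exact: enorm_ball_compact.
move=> [M [_ /(_ (`|M| + 1))]] h; exists (`|M| + 1); first by rewrite addr_ge0.
move=> u ur; apply: h; last by exists u.
by rewrite (le_lt_trans (ler_norm _))// ltrDl.
Qed.

Lemma bounded_ex_cluster n (x : nat -> 'cV[R]_n) (r : R) :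
  (forall k, enorm (x k) <= r) ->
  exists l : 'cV[R]_n, forall (e : R) N, 0 < e -> exists2 k, (N <= k)%N & enorm (x k - l) < e.
Proof.
move=> xr.
have [|l [_ xl]] := enorm_ball_compact (n := n) (r := r) (F := x @ \oo) _.
  by exists 0 => // k _; exact: xr.
exists l => e N e0.
have [] := xl [set x k | k in [set k | (N <= k)%N]] [set y | enorm (y - l) < e].
- by exists N => // k /= Nk; exists k.
- by apply/near_enormP; exists e.
- by move=> _ [[k /= Nk <-] xkl]; exists k.
Qed.

End ColumnTopology.

Section Differentiable.
Context {R : realType}.

Lemma cV_sum_delta n (v : 'cV[R]_n) : v = \sum_i v i 0 *: delta_mx i 0.
Proof.
rewrite {1}(matrix_sum_delta v); apply: eq_bigr => i _.
by rewrite big_ord_recl big_ord0 addr0 ord1.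
Qed.

Lemma differentiable_is_derive n (h : 'cV[R]_n -> R) x v :
  differentiable h x -> is_derive x v h (dot (grad h x) v).
Proof.
move=> dh; split; first exact: diff_derivable.
rewrite deriveE// {1}(cV_sum_delta v) linear_sum; apply: eq_bigr => i _.
by rewrite linearZ/= mxE deriveE// mulrC.
Qed.

Lemma is_derive_hess n (h : 'cV[R]_n -> R) x v i :
  differentiable (grad h) x ->
  is_derive x v (fun y => grad h y i 0) ((hess h x *m v) i 0).
Proof.
move=> dg; have := @differentiable_is_derive _ (fun y => grad h y i 0) x v.
rewrite (_ : dot _ v = (hess h x *m v) i 0).
  by apply; exact: (differentiable_comp dg (differentiable_coord _ i 0)).
by rewrite mxE; apply: eq_bigr => j _; rewrite !mxE.
Qed.

Section Schwarz.
Variables (n : nat) (h : 'cV[R]_n -> R).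
Variables (G : 'cV[R]_n -> 'cV[R]_n) (H : 'cV[R]_n -> 'M[R]_n).
Hypothesis dh : forall u v, is_derive u v h (dot (G u) v).
Hypothesis dG : forall u v i, is_derive u v (fun y => G y i 0) ((H u *m v) i 0).

Lemma second_difference x p r :
  exists2 z, enorm (z - x) <= enorm p + enorm r &
  h (x + p + r) - h (x + p) - h (x + r) + h x = dot p (H z *m r).
Proof.
have [t|t t01 E] := @mean_value01 R
  (fun s => h (x + r + s *: p) - h (x + s *: p))
  (fun s => dot (G (x + r + s *: p)) p - dot (G (x + s *: p)) p).
  by move=> _; apply: is_deriveB; exact: is_derive_segment.
have [//|||z _ [zu Ez]] := @mean_value_gradient R n setT G H _ _
  (x + t *: p) (x + r + t *: p) p => //.
have rE : x + r + t *: p - (x + t *: p) = r.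
  by apply/matrixP => a b; rewrite !mxE; ring.
rewrite rE in zu Ez.
exists z.
  have -> : z - x = (z - (x + t *: p)) + t *: p.
    by rewrite opprD addrA subrK.
  apply: le_trans (ler_enormD _ _) _; rewrite addrC lerD// enormZ.
  rewrite ler_piMl ?enorm_ge0//.
  by case/andP: t01 => t0 t1; rewrite ger0_norm.
rewrite -Ez dotBr ![dot p _]dotC -E !scale1r !scale0r !addr0.
rewrite [x + r + p]addrAC; ring.
Qed.

Lemma hessian_symmetric x : {for x, continuous H} -> (H x)^T = H x.
Proof.
move=> cH; apply/matrixP => i j; rewrite mxE; apply/eqP.
apply: contraT => Hij.
have e0 : 0 < `|H x j i - H x i j| / 2 by rewrite divr_gt0// normr_gt0 subr_eq0.
have /continuous_enormP/(_ _ e0)[d d0 dP] := cH.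
pose t := d / 4.
have t0 : 0 < t by rewrite divr_gt0.
have ed k : enorm (t *: delta_mx k 0 : 'cV[R]_n) <= t.
  rewrite enormZ gtr0_norm// ler_piMr ?(ltW t0)//.
  by rewrite /enorm dot_delta mxE !eqxx /= sqrtr1.
have tH z k l : dot (t *: delta_mx k 0) (H z *m (t *: delta_mx l 0)) =
    t ^+ 2 * H z k l.
  rewrite dotZl -scalemxAr dotZr mulrA -expr2; congr (_ * _).
  by rewrite dotC dot_delta -colE mxE.
have [z zx Ez] := second_difference x (t *: delta_mx i 0) (t *: delta_mx j 0).
have [y yx Ey] := second_difference x (t *: delta_mx j 0) (t *: delta_mx i 0).
rewrite tH in Ez; rewrite tH in Ey.
have E : H z i j = H y j i.
  apply: (mulfI (lt0r_neq0 (exprn_gt0 2 t0))).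
  rewrite -Ez -Ey [x + _ + _ in RHS]addrAC; ring.
have := ed i; have := ed j => edj edi.
have zd : enorm (z - x) < d by apply: le_lt_trans zx _; rewrite /t in edi edj *; lra.
have yd : enorm (y - x) < d by apply: le_lt_trans yx _; rewrite /t in edi edj *; lra.
have := le_lt_trans (coord_le_mx_norm _ i j) (dP _ zd); rewrite !mxE.
have := le_lt_trans (coord_le_mx_norm _ j i) (dP _ yd); rewrite !mxE E.
set a := H y j i; set b := H x j i; set c := H x i j => h1 h2.
have := ler_distD a b c; rewrite distrC in h1; lra.
Qed.

End Schwarz.

End Differentiable.

Section Composition.
Context {R : realType}.

Lemma is_derive_mulmx m p (B : 'M[R]_(m, p)) (h : 'cV[R]_m -> R) u v dh :
  is_derive (B *m u) (B *m v) h dh -> is_derive u v (fun y => h (B *m y)) dh.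
Proof. by apply: is_derive_line => s; rewrite mulmxDr -scalemxAr. Qed.

Variables (m p : nat) (f : 'cV[R]_m -> R) (B : 'M[R]_(m, p)).
Hypothesis f_C2 : twice_continuously_differentiable f.

Definition comp_grad u := B^T *m grad f (B *m u).

Definition comp_hess u := B^T *m hess f (B *m u) *m B.

Lemma is_derive_comp u v :
  is_derive u v (fun y => f (B *m y)) (dot (comp_grad u) v).
Proof.
case: f_C2 => df _ _; rewrite -dot_mulmxr; apply: is_derive_mulmx.
exact: differentiable_is_derive.
Qed.

Lemma is_derive_comp_grad u v i :
  is_derive u v (fun y => comp_grad y i 0) ((comp_hess u *m v) i 0).
Proof.
have E (w : 'cV[R]_m) : (B^T *m w) i 0 = dot (col i B) w.
  by rewrite mxE; apply: eq_bigr => k _; rewrite !mxE.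
rewrite /comp_hess -!mulmxA E.
have -> : (fun y => comp_grad y i 0) = fun y => dot (col i B) (grad f (B *m y)).
  by apply/funext => y; rewrite -E.
apply: is_derive_dot => k.
apply: (@is_derive_mulmx _ _ B (fun z => grad f z k 0)).
by apply: is_derive_hess; case: f_C2.
Qed.

Lemma tr_comp_hess u : (comp_hess u)^T = comp_hess u.
Proof.
case: f_C2 => df dg ch; rewrite /comp_hess !trmx_mul trmxK mulmxA.
congr (_ *m _ *m _).
apply: (@hessian_symmetric _ _ f (grad f)) => [z v|z v i|]; last exact: ch.
  exact: differentiable_is_derive.
exact: is_derive_hess.
Qed.

Lemma enorm_comp_hess_sub u w v :
  enorm ((comp_hess u - comp_hess w) *m v) <=
  mxsum B^T * mxsum (hess f (B *m u) - hess f (B *m w)) * mxsum B * enorm v.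
Proof.
rewrite /comp_hess -mulmxBl -mulmxBr -!mulmxA.
apply: le_trans (enorm_mulmx _ _) _; rewrite -!mulrA ler_wpM2l ?mxsum_ge0//.
apply: le_trans (enorm_mulmx _ _) _; rewrite ler_wpM2l ?mxsum_ge0//.
exact: enorm_mulmx.
Qed.

End Composition.

Lemma psi_gradE (R : realType) m n (f : 'cV[R]_m -> R) (A : 'M[R]_(m, n)) u :
  twice_continuously_differentiable f -> grad (psi f A) u = comp_grad f A u.
Proof.
move=> f_C2; apply/matrixP => i j; rewrite ord1 mxE.
by have [_ ->] := is_derive_comp A f_C2 u (delta_mx i 0); rewrite dot_delta.
Qed.

Lemma psi_taylor_bounded (R : realType) m n (f : 'cV[R]_m -> R)
    (A : 'M[R]_(m, n)) (r : R) : twice_continuously_differentiable f ->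
  exists2 M, 0 <= M & forall u w, enorm u <= r -> enorm w <= r ->
    `|psi f A w - psi f A u - dot (grad (psi f A) u) (w - u)|
      <= M * enorm (w - u) ^+ 2.
Proof.
move=> f_C2; have [_ _ ch] := f_C2.
have [K K0 hK] := enorm_ball_bounded (mxsum A * r) ch.
pose M := mxsum A^T * ((m * m)%:R * K) * mxsum A.
have M0 : 0 <= M by rewrite !mulr_ge0// ?mxsum_ge0.
exists M => // u w ur wr; rewrite psi_gradE//.
pose B := [set u : 'cV[R]_n | enorm (u - 0) <= r].
apply: (@taylor1 R n B (psi f A) (comp_grad f A) (comp_hess f A)) => //.
- exact: enorm_ball_segment.
- by move=> *; exact: is_derive_comp.
- by move=> *; exact: is_derive_comp_grad.
- by rewrite /B/= subr0.
- by rewrite /B/= subr0.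
move=> z v; rewrite /B/= subr0 => zr.
rewrite /comp_hess -!mulmxA.
apply: le_trans (enorm_mulmx _ _) _; rewrite -!mulrA ler_wpM2l ?mxsum_ge0//.
apply: le_trans (enorm_mulmx _ _) _; rewrite mulrA.
apply: ler_pM; rewrite ?mxsum_ge0 ?enorm_ge0// ?enorm_mulmx//.
apply: le_trans (mxsum_le_norm _) _; rewrite ler_wpM2l//; apply: hK.
apply: le_trans (enorm_mulmx _ _) _; rewrite ler_wpM2l// mxsum_ge0//.
Qed.

Section Power.
Context {R : realType}.

Lemma is_derive_dir (phi : R -> R) (a w d : R) :
  is_derive a 1 phi d -> is_derive a w phi (w * d).
Proof.
move=> [dphi <-]; have diff : differentiable phi a by exact/derivable1_diffP.
split; first exact: diff_derivable.
by rewrite !deriveE// -[in LHS](mulr1 w) -[w * 1]/(w *: 1) linearZ.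
Qed.

Lemma le_powR_npos (r x y : R) : r <= 0 -> 0 < x -> x <= y -> y `^ r <= x `^ r.
Proof.
move=> r0 x0 xy; rewrite -[r]opprK !(powRN _ (- r)).
have y0 := lt_le_trans x0 xy.
rewrite lef_pV2 ?posrE ?powR_gt0//.
by apply: ge0_ler_powR; rewrite ?oppr_ge0// nnegrE ltW.
Qed.

Lemma near_same_sign (a : R) : a != 0 -> \forall b \near a, Num.sg b = Num.sg a.
Proof.
rewrite neq_lt => /orP[a0|a0].
  by near=> b; rewrite !ltr0_sg//; near: b; exact: lt_nbhsl.
by near=> b; rewrite !gtr0_sg//; near: b; exact: lt_nbhsr.
Unshelve. all: by end_near. Qed.

Lemma is_derive_normr_powR r (a : R) : a != 0 ->
  is_derive a 1 (fun b => `|b| `^ r) (r * Num.sg a * `|a| `^ (r - 1)).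
Proof.
move=> a0; have an0 : 0 < `|a| by rewrite normr_gt0.
have := is_derive_dir (Num.sg a) (is_derive1_powR r an0).
rewrite mulrCA mulrA => h.
apply: (@near_eq_is_derive _ _ _ (fun b => (Num.sg a * b) `^ r)).
  apply: filterS (near_same_sign a0) => b <-.
  by rewrite -normrEsg.
move: h; apply: is_derive_line => s; congr (_ `^ _).
by rewrite /GRing.scale/= normrEsg; ring.
Qed.

Lemma is_derive_sgr_powR r (a : R) : a != 0 ->
  is_derive a 1 (fun b => r * Num.sg b * `|b| `^ (r - 1))
    (r * (r - 1) * `|a| `^ (r - 2)).
Proof.
move=> a0.
apply: (@near_eq_is_derive _ _ _ ((r * Num.sg a) *: fun b => `|b| `^ (r - 1))).
  by apply: filterS (near_same_sign a0) => b ->.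
have := is_deriveZ (r * Num.sg a) (is_derive_normr_powR (r - 1) a0).
move/is_derive_eq; apply.
rewrite (_ : r - 1 - 1 = r - 2); last by ring.
rewrite /GRing.scale/= -[RHS]mul1r -(_ : Num.sg a ^+ 2 = 1); first ring.
by rewrite sqr_sg a0.
Qed.

Lemma normr_powR_lipschitz r (a0 : R) : r <= 1 -> a0 != 0 ->
  exists2 L, 0 <= L & forall a b, `|a - a0| <= `|a0| / 2 ->
    `|b - a0| <= `|a0| / 2 -> `| `|a| `^ r - `|b| `^ r| <= L * `|a - b|.
Proof.
move=> r1 a00; exists (`|r| * (`|a0| / 2) `^ (r - 1)).
  by rewrite mulr_ge0// powR_ge0.
move=> a b ha hb.
have h2 : 0 < `|a0| / 2 by rewrite divr_gt0// normr_gt0.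
have hc t : 0 <= t <= 1 -> `|a0| / 2 <= `|b + t * (a - b)|.
  move=> /andP[t0 t1].
  have : `|b + t * (a - b) - a0| <= `|a0| / 2.
    rewrite (_ : _ - a0 = (1 - t) * (b - a0) + t * (a - a0)); last by ring.
    apply: le_trans (ler_normD _ _) _; rewrite !normrM (ger0_norm t0).
    rewrite (@ger0_norm _ (1 - t)) ?subr_ge0//.
    have : (1 - t) * `|b - a0| <= (1 - t) * (`|a0| / 2).
      by rewrite ler_wpM2l ?subr_ge0.
    have : t * `|a - a0| <= t * (`|a0| / 2) by rewrite ler_wpM2l.
    lra.
  have := ler_normB (b + t * (a - b)) (b + t * (a - b) - a0).
  rewrite subKr; lra.
have [t t01|t t01] := @mean_value01 R (fun s => `|b + s * (a - b)| `^ r)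
  (fun s => (a - b) * (r * Num.sg (b + s * (a - b)) *
    `|b + s * (a - b)| `^ (r - 1))).
  have c0 : b + t * (a - b) != 0.
    by rewrite -normr_gt0; apply: lt_le_trans h2 (hc _ t01).
  have := is_derive_dir (a - b) (is_derive_normr_powR r c0).
  apply: is_derive_line => s; congr (`|_| `^ _).
  by rewrite /GRing.scale/= mulr1; ring.
rewrite mul1r mul0r addr0 subrKC => ->; rewrite normrM mulrC ler_wpM2r//.
have c0 : 0 < `|b + t * (a - b)| by apply: lt_le_trans h2 (hc _ t01).
rewrite !normrM normr_sg -normr_gt0 c0 mulr1 ler_wpM2l//.
rewrite ger0_norm ?powR_ge0//; apply: le_powR_npos => //.
  by rewrite subr_le0.
exact: hc.
Qed.

End Power.

(** * The smooth function F_S *)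

Section SmoothBall.
Context {R : realType}.

(* One constant L serves for all the estimates that follow from h being C^2 with
   Lipschitz Hessian near u0. *)
Record smooth_ball n (h : 'cV[R]_n -> R) (u0 : 'cV[R]_n) (rho L : R) : Prop := {
  sb_rho : 0 < rho;
  sb_L : 0 <= L;
  sb_sym : forall u, enorm (u - u0) <= rho -> (hess h u)^T = hess h u;
  sb_bound : forall u v, enorm (u - u0) <= rho ->
    enorm (hess h u *m v) <= L * enorm v;
  sb_lip : forall u w v, enorm (u - u0) <= rho -> enorm (w - u0) <= rho ->
    enorm ((hess h u - hess h w) *m v) <= L * enorm (u - w) * enorm v;
  sb_grad_lip : forall u w, enorm (u - u0) <= rho -> enorm (w - u0) <= rho ->
    enorm (grad h w - grad h u) <= L * enorm (w - u);
  sb_grad_taylor : forall u w, enorm (u - u0) <= rho -> enorm (w - u0) <= rho ->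
    enorm (grad h w - grad h u - hess h u *m (w - u)) <= L * enorm (w - u) ^+ 2;
  sb_taylor1 : forall u w, enorm (u - u0) <= rho -> enorm (w - u0) <= rho ->
    `|h w - h u - dot (grad h u) (w - u)| <= L * enorm (w - u) ^+ 2;
  sb_taylor2 : forall u w, enorm (u - u0) <= rho -> enorm (w - u0) <= rho ->
    `|h w - h u - dot (grad h u) (w - u)
      - dot (w - u) (hess h u *m (w - u)) / 2| <= L * enorm (w - u) ^+ 3 }.

Lemma finite_pos_lb n (c : 'I_n -> R) : (forall i, 0 < c i) ->
  exists2 e, 0 < e & forall i, e <= c i.
Proof.
move=> c0; exists (\big[Num.min/1]_i c i); last by move=> i; exact: bigmin_le_cond.
by apply/bigmin_gtP; split=> // i _; exact: c0.
Qed.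

Lemma lipschitz_ball m p r (h : 'cV[R]_m -> 'M[R]_(p, r)) z :
  locally_lipschitz h -> exists rho L, [/\ 0 < rho, 0 <= L &
    forall u w, enorm (u - z) < rho -> enorm (w - z) < rho ->
      `|h u - h w| <= L * `|u - w|].
Proof.
move=> /(_ z)[U /near_enormP[rho rho0 rhoU] [M [_ hM]]].
exists rho, (`|M| + 1); split => // u w uz wz.
apply: (hM (`|M| + 1) _ (u, w)); last by split; exact: rhoU.
by rewrite (le_lt_trans (ler_norm _))// ltrDl.
Qed.

Lemma enorm_diag_mulmx n (d : 'rV[R]_n) (v : 'cV[R]_n) :
  enorm (diag_mx d *m v) <= (\sum_i `|d 0 i|) * enorm v.
Proof.
apply: le_trans (enorm_le_sum _) _; rewrite mulr_suml; apply: ler_sum => i _.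
by rewrite mul_diag_mx mxE normrM ler_wpM2l// coord_le_enorm.
Qed.

Variables (m p : nat) (f : 'cV[R]_m -> R) (B : 'M[R]_(m, p)) (lam q : R).
Hypothesis f_C2 : twice_continuously_differentiable f.
Hypothesis f_lip : locally_lipschitz (hess f).
Hypothesis q_le1 : q <= 1.

Definition lq_obj u := f (B *m u) + lam * lqq q u.

Definition lq_grad u : 'cV[R]_p := comp_grad f B u +
  \col_i (lam * (q * Num.sg (u i 0) * `|u i 0| `^ (q - 1))).

Definition lq_hess u : 'M[R]_p := comp_hess f B u +
  diag_mx (\row_i (lam * (q * (q - 1) * `|u i 0| `^ (q - 2)))).

Lemma is_derive_coord (u v : 'cV[R]_p) (phi : R -> R) i d :
  is_derive (u i 0) 1 phi d -> is_derive u v (fun y => phi (y i 0)) (v i 0 * d).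
Proof.
move=> /(is_derive_dir (v i 0)); apply: is_derive_line => s.
by rewrite !mxE.
Qed.

Lemma is_derive_lq_obj (u v : 'cV[R]_p) : (forall i, u i 0 != 0) ->
  is_derive u v lq_obj (dot (lq_grad u) v).
Proof.
move=> u0; rewrite /lq_obj dotDl; apply: is_deriveD; first exact: is_derive_comp.
have -> : (fun y : 'cV[R]_p => lam * lqq q y) =
    \sum_(i < p) (lam *: (fun y : 'cV[R]_p => `|y i 0| `^ q)).
  by apply/funext => y; rewrite fct_sumE /lqq mulr_sumr.
apply: is_derive_sum => i; rewrite mxE -mulrA; apply: is_deriveZ.
rewrite [_ * v i 0]mulrC; apply: (@is_derive_coord u v (fun b => `|b| `^ q)).
exact: is_derive_normr_powR.
Qed.

Lemma is_derive_lq_grad (u v : 'cV[R]_p) i : (forall i, u i 0 != 0) ->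
  is_derive u v (fun y => lq_grad y i 0) ((lq_hess u *m v) i 0).
Proof.
move=> u0; rewrite /lq_hess mulmxDl mxE.
have -> : (fun y => lq_grad y i 0) = (fun y => comp_grad f B y i 0) +
    lam *: (fun y : 'cV[R]_p => q * Num.sg (y i 0) * `|y i 0| `^ (q - 1)).
  by apply/funext => y; rewrite /lq_grad mxE [X in _ + X = _]mxE.
apply: is_deriveD; first exact: is_derive_comp_grad.
rewrite mul_diag_mx mxE mxE -mulrA; apply: is_deriveZ; rewrite [_ * v i 0]mulrC.
apply: (@is_derive_coord u v (fun b => q * Num.sg b * `|b| `^ (q - 1))).
exact: is_derive_sgr_powR.
Qed.

Lemma grad_lq_obj (u : 'cV[R]_p) : (forall i, u i 0 != 0) -> grad lq_obj u = lq_grad u.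
Proof.
move=> u0; apply/matrixP => i j; rewrite ord1 mxE.
by have [_ ->] := is_derive_lq_obj (delta_mx i 0) u0; rewrite dot_delta.
Qed.

Lemma hess_lq_obj (u : 'cV[R]_p) : (forall i, u i 0 != 0) -> hess lq_obj u = lq_hess u.
Proof.
move=> u0; apply/matrixP => i j; rewrite mxE.
rewrite (@near_eq_derive _ _ _ _ (fun y => lq_grad y i 0)).
  have [_ ->] := is_derive_lq_grad (delta_mx j 0) i u0.
  by rewrite -colE mxE.
have [|e e0 eP] := @finite_pos_lb p (fun i => `|u i 0|).
  by move=> k; rewrite normr_gt0.
apply/near_enormP; exists e => // y yu; rewrite grad_lq_obj// => k.
apply: contraTneq (le_lt_trans (coord_le_enorm _ k) yu).
by rewrite !mxE => ->; rewrite sub0r normrN -leNgt.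
Qed.

Lemma ex_smooth_ball (u0 : 'cV[R]_p) : (forall i, u0 i 0 != 0) ->
  exists rho L, smooth_ball lq_obj u0 rho L /\
    forall u, enorm (u - u0) <= rho -> forall i, u i 0 != 0.
Proof.
move=> u0n0.
have [r1 [L1 [r10 L10 hL1]]] := lipschitz_ball (B *m u0) f_lip.
have [|r2 r20 hr2] := @finite_pos_lb p (fun i => `|u0 i 0| / 2).
  by move=> i; rewrite divr_gt0// normr_gt0.
have q2 : q - 2 <= 1 by rewrite lerBlDr (le_trans q_le1)// lerDl.
have /choice[Ls hLs] : forall i, exists L, 0 <= L /\
    forall a b, `|a - u0 i 0| <= `|u0 i 0| / 2 ->
    `|b - u0 i 0| <= `|u0 i 0| / 2 ->
    `| `|a| `^ (q - 2) - `|b| `^ (q - 2)| <= L * `|a - b|.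
  by move=> i; have [L L0 hL] := normr_powR_lipschitz q2 (u0n0 i); exists L.
have mB := mxsum_ge0 B.
have mB1 : 0 < mxsum B + 1 by rewrite ltr_wpDl.
pose rho := Num.min r2 (r1 / (mxsum B + 1) / 2).
have rho0 : 0 < rho by rewrite lt_min r20 !divr_gt0.
have Bball u : enorm (u - u0) <= rho -> enorm (B *m u - B *m u0) < r1.
  rewrite le_min => /andP[_ hu]; rewrite -mulmxBr.
  apply: le_lt_trans (enorm_mulmx _ _) _.
  have : mxsum B * enorm (u - u0) <= (mxsum B + 1) * (r1 / (mxsum B + 1) / 2).
    by apply: ler_pM; rewrite ?enorm_ge0// lerDl.
  move/le_lt_trans; apply.
  rewrite mulrA mulrCA divff ?gt_eqF// mulr1; lra.
have hball u i : enorm (u - u0) <= rho -> `|u i 0 - u0 i 0| <= `|u0 i 0| / 2.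
  rewrite le_min => /andP[hu _].
  have := coord_le_enorm (u - u0) i; rewrite !mxE => /le_trans; apply.
  exact: le_trans hu (hr2 i).
have nball u : enorm (u - u0) <= rho -> forall i, u i 0 != 0.
  move=> hu i; apply: contraTneq (hball _ i hu) => ->.
  by rewrite sub0r normrN -ltNge gtr_pMr ?normr_gt0// invf_lt1// ltr1n.
pose K1 := mxsum B^T * ((m * m)%:R * (L1 * mxsum B)) * mxsum B.
pose K2 := \sum_i `|lam * (q * (q - 1))| * Ls i.
have K10 : 0 <= K1 by rewrite !mulr_ge0 ?mxsum_ge0.
have K20 : 0 <= K2.
  by apply: sumr_ge0 => i _; rewrite mulr_ge0//; case: (hLs i).
have Hlip u w v : enorm (u - u0) <= rho -> enorm (w - u0) <= rho ->
    enorm ((lq_hess u - lq_hess w) *m v) <= (K1 + K2) * enorm (u - w) * enorm v.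
  move=> hu hw.
  have -> (a b c d : 'M[R]_p) : a + b - (c + d) = (a - c) + (b - d).
    by rewrite opprD addrACA.
  rewrite mulmxDl.
  apply: le_trans (ler_enormD _ _) _; rewrite !mulrDl lerD//.
    apply: le_trans (enorm_comp_hess_sub _ _ _ _ _) _.
    rewrite ler_wpM2r ?enorm_ge0// /K1 [leRHS]mulrAC ler_wpM2r ?mxsum_ge0//.
    rewrite -mulrA ler_wpM2l ?mxsum_ge0//; apply: le_trans (mxsum_le_norm _) _.
    rewrite -mulrA ler_wpM2l//.
    apply: le_trans (hL1 _ _ (Bball _ hu) (Bball _ hw)) _.
    rewrite -mulrA ler_wpM2l// -mulmxBr; apply: le_trans (norm_le_enorm _) _.
    exact: enorm_mulmx.
  rewrite -linearB/=; apply: le_trans (enorm_diag_mulmx _ _) _.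
  rewrite ler_wpM2r ?enorm_ge0// mulr_suml; apply: ler_sum => i _.
  rewrite !mxE (_ : _ - _ = lam * (q * (q - 1)) *
    (`|u i 0| `^ (q - 2) - `|w i 0| `^ (q - 2))); last by ring.
  rewrite normrM -mulrA; apply: ler_wpM2l => //.
  have [Li0 /(_ _ _ (hball _ i hu) (hball _ i hw))] := hLs i.
  move/le_trans; apply; apply: ler_wpM2l => //.
  by have := coord_le_enorm (u - w) i; rewrite !mxE.
pose L := K1 + K2 + (mxsum (lq_hess u0) + (K1 + K2) * rho).
have K12 : 0 <= K1 + K2 by exact: addr_ge0.
have M0 : 0 <= mxsum (lq_hess u0) + (K1 + K2) * rho.
  by rewrite addr_ge0 ?mxsum_ge0// mulr_ge0// ltW.
have L0 : 0 <= L by exact: addr_ge0.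
have u0ball : enorm (u0 - u0) <= rho by rewrite subrr enorm0 ltW.
have Hbnd u v : enorm (u - u0) <= rho -> enorm (lq_hess u *m v) <= L * enorm v.
  move=> hu; rewrite -[lq_hess u](subrK (lq_hess u0)) mulmxDl.
  apply: le_trans (ler_enormD _ _) _.
  have := enorm_mulmx (lq_hess u0) v.
  have := Hlip u u0 v hu u0ball.
  have : (K1 + K2) * enorm (u - u0) * enorm v <= (K1 + K2) * rho * enorm v.
    by rewrite ler_wpM2r ?enorm_ge0// ler_wpM2l.
  have := mulr_ge0 K12 (enorm_ge0 v).
  rewrite /L !mulrDl; lra.
have HlipL u w v : enorm (u - u0) <= rho -> enorm (w - u0) <= rho ->
    enorm ((lq_hess u - lq_hess w) *m v) <= L * enorm (u - w) * enorm v.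
  move=> hu hw; apply: le_trans (Hlip _ _ _ hu hw) _.
  by rewrite !ler_wpM2r ?enorm_ge0// lerDl.
pose Bl := [set u : 'cV[R]_p | enorm (u - u0) <= rho].
have Bseg : segment_closed Bl by exact: enorm_ball_segment.
have dh u v : Bl u -> is_derive u v lq_obj (dot (lq_grad u) v).
  by move=> /nball; exact: is_derive_lq_obj.
have dG u v i : Bl u -> is_derive u v (fun y => lq_grad y i 0) ((lq_hess u *m v) i 0).
  by move=> /nball; exact: is_derive_lq_grad.
exists rho, L; split; last exact: nball.
split => // [u hu|u v hu|u w v hu hw|u w hu hw|u w hu hw|u w hu hw|u w hu hw];
  rewrite ?hess_lq_obj ?grad_lq_obj; try exact: nball.
- by rewrite /lq_hess linearD/= tr_diag_mx tr_comp_hess.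
- exact: Hbnd.
- exact: HlipL.
- by apply: (gradient_lipschitz Bseg dG) => // z v; exact: Hbnd.
- exact: (taylor_gradient Bseg dG L0 HlipL).
- by apply: (taylor1 Bseg dh dG) => // z v; exact: Hbnd.
- exact: (taylor2 Bseg dh dG L0 HlipL).
Qed.

End SmoothBall.

(** * Local convergence of the regularized Newton method *)

Section NewtonDirection.
Context {R : realType}.
Variables (n : nat) (M : 'M[R]_n) (b1 s : R) (r d : 'cV[R]_n).
Let zeta := Num.max (- lambda_min M) 0.
Hypothesis Msym : M^T = M.
Hypothesis b1_gt1 : 1 < b1.
Hypothesis d_newton : (M + (b1 * zeta + s)%:M) *m d = - r.

Lemma newton_dot : - dot r d = dot d (M *m d) + (b1 * zeta + s) * dot d d.
Proof.
by rewrite -dotNl -d_newton mulmxDl mul_scalar_mx dotDl dotZl (dotC _ d).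
Qed.

Lemma regularized_coercive v :
  ((b1 - 1) * zeta + s) * dot v v <= dot v ((M + (b1 * zeta + s)%:M) *m v).
Proof.
rewrite mulmxDl mul_scalar_mx dotDr dotZr.
have := rayleigh v Msym.
have : - lambda_min M * dot v v <= zeta * dot v v.
  by rewrite ler_wpM2r ?dot_ge0// le_max lexx.
by rewrite !mulrDl; lra.
Qed.

Lemma newton_descent : 0 <= s -> s * enorm d ^+ 2 <= - dot r d.
Proof.
move=> s0; rewrite sqr_enorm; have := regularized_coercive d.
rewrite d_newton dotNr (dotC d) => /(le_trans _); apply.
rewrite ler_wpM2r ?dot_ge0// lerDr mulr_ge0//; first by rewrite subr_ge0 ltW.
by rewrite le_max lexx orbT.
Qed.

Lemma newton_norm : 0 <= s -> s * enorm d <= enorm r.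
Proof.
move=> s0; have [->|d0] := eqVneq d 0; first by rewrite enorm0 mulr0 enorm_ge0.
rewrite -(@ler_pM2r _ (enorm d)) ?enorm_gt0// -mulrA -expr2.
apply: le_trans (newton_descent s0) _; rewrite -dotNl -(enormN r).
exact: dot_le_enorm.
Qed.

End NewtonDirection.

Lemma near_succ (P : nat -> Prop) :
  (\forall k \near \oo, P k) -> \forall k \near \oo, P k.+1.
Proof. by move=> [N _ NP]; exists N => // k Nk; apply: NP; exact: leqW. Qed.

Section SmallReals.
Context {R : realType}.

Lemma ex_small_mul (K c : R) : 0 < c ->
  exists2 e, 0 < e & forall x, 0 <= x <= e -> K * x < c.
Proof.
move=> c0; have K1 : 0 < `|K| + 1 by rewrite ltr_wpDl.
exists (c / (`|K| + 1)); first by rewrite divr_gt0.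
move=> x /andP[x0]; rewrite ler_pdivlMr// mulrDr mulr1 => xc.
have := ler_wpM2r x0 (ler_norm K).
have [xp|xn] := ltP 0 x; first lra.
have -> : x = 0 by apply/eqP; rewrite eq_le x0 xn.
by rewrite mulr0.
Qed.

Lemma ex_small_powR (s c : R) : 0 < s -> 0 < c ->
  exists2 e, 0 < e & forall x, 0 <= x <= e -> x `^ s <= c.
Proof.
move=> s0 c0; exists (c `^ s^-1); first exact: powR_gt0.
move=> x /andP[x0 xc].
have -> : c = (c `^ s^-1) `^ s by rewrite -powRrM mulVf ?gt_eqF// powRr1// ltW.
by apply: ge0_ler_powR; rewrite ?nnegrE ?powR_ge0// ltW.
Qed.

End SmallReals.

Section LocalNewton.
Context {R : realType}.
Variables (n : nat) (h : 'cV[R]_n -> R) (u0 : 'cV[R]_n) (rad L : R).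
Variables (sigma rho beta b1 b2 : R).
Hypothesis sm : smooth_ball h u0 rad L.
Hypothesis sigma_gt0 : 0 < sigma.
Hypothesis sigma_lt1 : sigma < 1.
Hypothesis rho_lt : 0 < rho < 2^-1.
Hypothesis beta01 : 0 < beta < 1.
Hypothesis b1_gt1 : 1 < b1.
Hypothesis b2_gt0 : 0 < b2.

Local Notation zeta u := (Num.max (- lambda_min (hess h u)) 0).
Local Notation r u := (enorm (grad h u)).
Local Notation reg u := (b1 * zeta u + b2 * r u `^ sigma).
Local Notation armijo u d j :=
  (h (u + beta ^+ j *: d) <= h u + rho * beta ^+ j * dot (grad h u) d).

Lemma zeta_ge0 u : 0 <= zeta u.
Proof. by rewrite le_max lexx orbT. Qed.

Lemma b2r_ge0 u : 0 <= b2 * r u `^ sigma.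
Proof. by rewrite mulr_ge0 ?powR_ge0// ltW. Qed.

Lemma hess_bounded_reg : exists2 C, 0 < C & forall u d,
  enorm (u - u0) <= rad -> (hess h u + (reg u)%:M) *m d = - grad h u ->
  r u <= C * enorm d.
Proof.
have L0 := sb_L sm.
have rad0 := sb_rho sm.
have Rb0 : 0 <= r u0 + L * rad by rewrite addr_ge0 ?enorm_ge0// mulr_ge0// ltW.
have C0 : 0 <= L + (b1 * L + b2 * (r u0 + L * rad) `^ sigma).
  rewrite !addr_ge0// mulr_ge0 ?powR_ge0//; last exact: ltW.
  by rewrite ltW// (lt_trans _ b1_gt1).
exists (L + (b1 * L + b2 * (r u0 + L * rad) `^ sigma) + 1).
  by rewrite ltr_wpDl.
move=> u d hu E.
have hu0 : enorm (u0 - u0) <= rad by rewrite subrr enorm0 ltW.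
have zL : zeta u <= L.
  rewrite ge_max L0 andbT lerNl; apply: lambda_min_ge; first exact: (sb_sym sm).
    by rewrite oppr_le0.
  move=> v; rewrite mulNr lerNl -dotNl -sqr_enorm.
  apply: le_trans (dot_le_enorm _ _) _; rewrite enormN mulrC expr2 mulrA.
  by rewrite ler_wpM2r ?enorm_ge0// (sb_bound sm).
have rR : r u <= r u0 + L * rad.
  rewrite -[grad h u](subrK (grad h u0)) addrC.
  apply: le_trans (ler_enormD _ _) _; rewrite lerD2l.
  by apply: le_trans (sb_grad_lip sm hu0 hu) _; rewrite ler_wpM2l.
have rs : r u `^ sigma <= (r u0 + L * rad) `^ sigma.
  by apply: ge0_ler_powR; rewrite ?nnegrE ?enorm_ge0// ltW.
rewrite -enormN -E mulmxDl mul_scalar_mx.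
apply: le_trans (ler_enormD _ _) _; rewrite enormZ.
rewrite [X in _ <= X]mulrDl mul1r ler_wpDr ?enorm_ge0//.
rewrite mulrDl lerD ?(sb_bound sm)// ler_wpM2r ?enorm_ge0//.
rewrite ger0_norm; last first.
  rewrite addr_ge0 ?b2r_ge0// mulr_ge0 ?zeta_ge0//.
  by rewrite ltW// (lt_trans _ b1_gt1).
rewrite lerD// ler_wpM2l//; last exact: ltW.
by rewrite ltW// (lt_trans _ b1_gt1).
Qed.

Variables (u d : nat -> 'cV[R]_n).
Hypothesis u_cvg : forall e, 0 < e -> \forall k \near \oo, enorm (u k - u0) < e.
Hypothesis newton : \forall k \near \oo,
  (hess h (u k) + (reg (u k))%:M) *m d k = - grad h (u k).
Hypothesis line_search : \forall k \near \oo, exists mk : nat,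
  [/\ armijo (u k) (d k) mk, forall j, (j < mk)%N -> ~~ armijo (u k) (d k) j
    & u k.+1 = u k + beta ^+ mk *: d k].

(* A rejected trial step t d with t |d| small forces |grad|^sigma = O(t), and
   |grad| = O(|d|); so alpha |d| -> 0 implies grad -> 0. *)
Lemma newton_grad_cvg0 e : 0 < e -> \forall k \near \oo, r (u k) < e.
Proof.
move=> e0; have [C C0 hC] := hess_bounded_reg.
have L0 := sb_L sm; have rad0 := sb_rho sm.
have /andP[rho0 rho12] := rho_lt; have /andP[beta0 beta1] := beta01.
have rho1 : 0 < 1 - rho by lra.
pose c := (1 - rho) * (b2 * e `^ sigma) * (e / C).
have c0 : 0 < c by rewrite !mulr_gt0 ?powR_gt0// invr_gt0.
have [e1 e10 he1] := ex_small_mul C e0.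
have [e2 e20 he2] := ex_small_mul (L / beta) c0.
have r20 : 0 < rad / 2 by rewrite divr_gt0.
have [e3 e30 he3] := ex_small_mul (beta^-1) r20.
pose e' := Num.min e1 (Num.min e2 e3).
have e'0 : 0 < e' by rewrite !lt_min e10 e20 e30.
have e'2 : 0 < e' / 2 by rewrite divr_gt0.
near=> k.
have uk : enorm (u k - u0) < rad / 2 by near: k; exact: u_cvg.
have ukb : enorm (u k - u0) <= rad by lra.
have u1 : enorm (u k - u0) < e' / 2 by near: k; exact: u_cvg.
have u2 : enorm (u k.+1 - u0) < e' / 2 
  by near: k; apply: (near_succ (P := fun k => _)); exact: u_cvg.
have E : (hess h (u k) + (reg (u k))%:M) *m d k = - grad h (u k) by near: k.
have [mk [_ hmk uE]] : exists mk : nat,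
  [/\ armijo (u k) (d k) mk, forall j, (j < mk)%N -> ~~ armijo (u k) (d k) j
    & u k.+1 = u k + beta ^+ mk *: d k] by near: k.
have hstep : beta ^+ mk * enorm (d k) <= e'.
  rewrite -[beta ^+ mk]ger0_norm ?exprn_ge0 ?ltW// -enormZ.
  have -> : beta ^+ mk *: d k = (u k.+1 - u0) - (u k - u0).
    by rewrite uE opprB addrA subrK addrC addKr.
  have := ler_enormB (u k.+1 - u0) (u k - u0); lra.
have rC := hC _ _ ukb E.
rewrite ltNge; apply/negP => er.
have dC : e / C <= enorm (d k).
  by rewrite ler_pdivrMr// mulrC; apply: le_trans er rC.
have d0 : 0 < enorm (d k) by apply: lt_le_trans dC; rewrite divr_gt0.
case: mk => [|j] in hmk uE hstep.
  have : C * enorm (d k) < e.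
    apply: he1; rewrite enorm_ge0/=; apply: le_trans (_ : e' <= e1).
      by rewrite expr0 mul1r in hstep.
    by rewrite ge_min lexx.
  lra.
have := hmk j (ltnSn j); rewrite -ltNge; set t := beta ^+ j => hlt.
have t0 : 0 < t by rewrite exprn_gt0.
have td : t * enorm (d k) <= beta^-1 * e'.
  by rewrite ler_pdivlMl// mulrA -exprS.
have e'b e'' : e' <= e'' -> 0 <= e' <= e'' by rewrite (ltW e'0).
have td3 : beta^-1 * e' < rad / 2.
  by apply/he3/e'b; rewrite !ge_min lexx !orbT.
have utb : enorm (u k + t *: d k - u0) <= rad.
  rewrite addrAC; apply: le_trans (ler_enormD _ _) _.
  rewrite enormZ gtr0_norm//; lra.
have ht := le_trans (ler_norm _) (sb_taylor1 sm ukb utb).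
have tE : u k + t *: d k - u k = t *: d k by rewrite addrC addKr.
rewrite tE dotZr enormZ gtr0_norm// in ht.
have Hs := sb_sym sm ukb.
have hd := newton_descent Hs b1_gt1 E (b2r_ge0 _).
set D := dot _ _ in hlt ht hd.
have h1 : (1 - rho) * (b2 * r (u k) `^ sigma * enorm (d k) ^+ 2) <=
    L * t * enorm (d k) ^+ 2.
  rewrite -(ler_pM2l t0).
  have : t * ((1 - rho) * (b2 * r (u k) `^ sigma * enorm (d k) ^+ 2))
      <= t * ((1 - rho) * - D) by rewrite !ler_wpM2l// ltW.
  rewrite exprMn in ht *; move: hlt ht; set N := enorm (d k) ^+ 2.
  move=> hlt ht; rewrite (_ : t * (L * t * N) = L * (t ^+ 2 * N)); last by ring.
  lra.
have h2 : (1 - rho) * (b2 * r (u k) `^ sigma) * enorm (d k) <= L * (t * enorm (d k)).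
  by rewrite -(ler_pM2r d0) -!mulrA -expr2; rewrite !mulrA in h1 *.
have h3 : c <= (1 - rho) * (b2 * r (u k) `^ sigma) * enorm (d k).
  rewrite /c; apply: ler_pM => //.
  - by rewrite ltW// !mulr_gt0// powR_gt0.
  - by rewrite divr_ge0// ltW.
  - rewrite ler_wpM2l ?(ltW rho1)// ler_wpM2l ?(ltW b2_gt0)//.
    by apply: ge0_ler_powR; rewrite ?nnegrE ?enorm_ge0 ?(ltW e0)// ltW.
have h4 : L * (t * enorm (d k)) <= L / beta * e' by rewrite -mulrA ler_wpM2l.
have : L / beta * e' < c by apply/he2/e'b; rewrite !ge_min lexx !orbT.
lra.
Unshelve. all: by end_near. Qed.

Section Pointwise.
Variables (w v p : 'cV[R]_n) (K : R).
Hypothesis w_ball : enorm (w - u0) <= rad.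
Hypothesis v_ball : enorm (v - u0) <= rad.
Hypothesis v_crit : grad h v = 0.
Hypothesis v_psd : psd (hess h v).
Hypothesis K_ge0 : 0 <= K.
Hypothesis wv : enorm (w - v) <= K * r w.
Hypothesis p_newton : (hess h w + (reg w)%:M) *m p = - grad h w.
Hypothesis r_gt0 : 0 < r w.
Hypothesis r_le1 : r w <= 1.

Let Cd := b1 / (b1 - 1) * K + L * K ^+ 2 / b2 + K.

Lemma zeta_le : zeta w <= L * K * r w.
Proof.
have L0 := sb_L sm.
have LKr : 0 <= L * K * r w by rewrite !mulr_ge0// ltW.
rewrite ge_max LKr andbT lerNl; apply: lambda_min_ge; first exact: (sb_sym sm).
  by rewrite oppr_le0.
move=> y; rewrite -[hess h w](subrK (hess h v)) mulmxDl dotDr.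
have [_ /(_ y) vy] := v_psd.
have : - dot y ((hess h w - hess h v) *m y) <= L * K * r w * dot y y.
  rewrite -dotNl -sqr_enorm expr2 mulrA.
  apply: le_trans (dot_le_enorm _ _) _; rewrite enormN mulrC.
  rewrite ler_wpM2r ?enorm_ge0//.
  apply: le_trans (sb_lip sm _ w_ball v_ball) _.
  by rewrite ler_wpM2r ?enorm_ge0// -mulrA ler_wpM2l.
by rewrite mulNr; lra.
Qed.

Lemma sqr_r_le : r w ^+ 2 <= r w * r w `^ sigma.
Proof.
rewrite expr2 ler_wpM2l ?enorm_ge0//.
by apply: ger1_powR; [rewrite r_gt0 r_le1|exact: ltW].
Qed.

Lemma direction_le : enorm p <= Cd * r w.
Proof.
have L0 := sb_L sm.
have b10 : 0 < b1 - 1 by rewrite subr_gt0.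
have r0 := ltW r_gt0.
have z0 := zeta_ge0 w.
have rs0 : 0 < r w `^ sigma by rewrite powR_gt0.
have pN := p_newton.
set c := reg w in pN.
pose g := (b1 - 1) * zeta w + b2 * r w `^ sigma.
have g0 : 0 < g by rewrite ltr_wpDl ?mulr_gt0// mulr_ge0// ltW.
pose e := grad h v - grad h w - hess h w *m (v - w).
have eL : enorm e <= L * K ^+ 2 / b2 * r w * g.
  apply: le_trans (sb_grad_taylor sm w_ball v_ball) _.
  rewrite enorm_distC.
  apply: (@le_trans _ _ (L * K ^+ 2 * (r w * r w `^ sigma))).
    rewrite -mulrA ler_wpM2l//.
    apply: (@le_trans _ _ (K ^+ 2 * r w ^+ 2)).
      by rewrite -exprMn ler_sqr ?nnegrE ?enorm_ge0// mulr_ge0.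
    by rewrite ler_wpM2l ?exprn_ge0// sqr_r_le.
  have -> : L * K ^+ 2 / b2 * r w * g =
      L * K ^+ 2 * (r w * (g / b2)).
    by rewrite [g / b2]mulrC !mulrA (mulrAC _ b2^-1).
  rewrite !ler_wpM2l ?mulr_ge0 ?exprn_ge0//.
  by rewrite ler_pdivlMr// mulrC /g lerDr mulr_ge0// ltW.
have cg : c <= b1 / (b1 - 1) * g.
  rewrite mulrAC ler_pdivlMr// /c /g.
  have := mulr_gt0 b2_gt0 rs0; set B := b2 * _ => B0.
  rewrite (_ : b1 * (_ + B) = (b1 * zeta w + B) * (b1 - 1) + B); last by ring.
  by rewrite lerDl ltW.
have c0 : 0 <= c by rewrite addr_ge0 ?b2r_ge0// mulr_ge0// ltW// (lt_trans _ b1_gt1).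
have pv : (hess h w + c%:M) *m (p + (w - v)) = c *: (w - v) + e.
  rewrite mulmxDr pN mulmxDl mul_scalar_mx /e v_crit sub0r.
  rewrite -(opprB w v) mulmxN opprK.
  by apply/matrixP => i j; rewrite !mxE; ring.
have : g * enorm (p + (w - v)) <= c * enorm (w - v) + enorm e.
  have [->|pv0] := eqVneq (p + (w - v)) 0.
    by rewrite enorm0 mulr0 addr_ge0 ?enorm_ge0// mulr_ge0// enorm_ge0.
  have := regularized_coercive b1 (b2 * r w `^ sigma) (sb_sym sm w_ball)
    (p + (w - v)).
  rewrite -/g -/c pv -sqr_enorm expr2 => h1.
  rewrite -(@ler_pM2r _ (enorm (p + (w - v)))) ?enorm_gt0// -mulrA.
  apply: le_trans h1 _; apply: le_trans (dot_le_enorm _ _) _.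
  rewrite mulrC ler_wpM2r ?enorm_ge0//; apply: le_trans (ler_enormD _ _) _.
  by rewrite enormZ ger0_norm.
have : c * enorm (w - v) <= b1 / (b1 - 1) * g * (K * r w).
  by apply: ler_pM; rewrite ?enorm_ge0.
move=> h1 h2.
have h3 : enorm (p + (w - v)) <= (b1 / (b1 - 1) * K + L * K ^+ 2 / b2) * r w.
  rewrite -(ler_pM2l g0); apply: le_trans h2 _; apply: le_trans (lerD h1 eL) _.
  by rewrite le_eqVlt; apply/orP; left; apply/eqP; ring.
rewrite -[p](addrK (w - v)); apply: le_trans (ler_enormB _ _) _.
by rewrite /Cd mulrDl lerD.
Qed.

Hypothesis wp_ball : enorm (w + p - u0) <= rad.

Lemma unit_step_armijo : L * enorm p <= b2 / 2 * r w `^ sigma -> armijo w p 0.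
Proof.
move=> hL; have L0 := sb_L sm.
have /andP[rho0 rho12] := rho_lt.
have := le_trans (ler_norm _) (sb_taylor2 sm w_ball wp_ball).
have -> : w + p - w = p by rewrite addrC addKr.
move=> ht; rewrite expr0 scale1r mulr1.
have D := newton_dot p_newton.
have N0 := dot_ge0 p; have z0 := zeta_ge0 w.
have Q := newton_descent (sb_sym sm w_ball) b1_gt1 p_newton (b2r_ge0 _).
have Q0 : 0 <= - dot (grad h w) p.
  by apply: le_trans Q; rewrite mulr_ge0 ?b2r_ge0 ?exprn_ge0 ?enorm_ge0.
have h3 : L * enorm p ^+ 3 <= b2 / 2 * r w `^ sigma * dot p p.
  by rewrite exprS sqr_enorm mulrA ler_wpM2r.
have h4 : 0 <= b1 * zeta w * dot p p.
  by rewrite !mulr_ge0// ltW// (lt_trans _ b1_gt1).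
have h5 : 0 <= (2^-1 - rho) * - dot (grad h w) p.
  by rewrite mulr_ge0// subr_ge0 ltW.
move: ht D h3 h5; set T := dot (grad h w) p; set Q2 := dot p (_ *m p).
rewrite mulrDl; set Z := _ * zeta w * _ in h4 *; set B := _ * dot p p.
have -> : b2 / 2 * r w `^ sigma * dot p p = B / 2 by rewrite /B; ring.
lra.
Qed.

Lemma newton_grad_next :
  r (w + p) <= ((b1 * L * K + b2) * Cd + L * Cd ^+ 2) * (r w * r w `^ sigma).
Proof.
have L0 := sb_L sm.
have b10 : 0 < b1 by rewrite (lt_trans _ b1_gt1).
have r0 := ltW r_gt0.
have z0 := zeta_ge0 w.
have Cd0 : 0 <= Cd.
  rewrite addr_ge0// addr_ge0//.
    by rewrite mulr_ge0// divr_ge0 ?subr_ge0 ?(ltW b10) ?(ltW b1_gt1).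
  by rewrite divr_ge0 ?mulr_ge0 ?exprn_ge0 ?(ltW b2_gt0).
have pC := direction_le.
have := sb_grad_taylor sm w_ball wp_ball.
have -> : w + p - w = p by rewrite addrC addKr.
set e := _ - _ *m p => he.
have -> : grad h (w + p) = e - reg w *: p.
  rewrite /e -[- grad h w]p_newton mulmxDl mul_scalar_mx.
  by apply/matrixP => i j; rewrite !mxE; ring.
apply: le_trans (ler_enormB _ _) _.
rewrite enormZ ger0_norm; last by rewrite addr_ge0 ?b2r_ge0// mulr_ge0// ltW.
have h1 : enorm e <= L * Cd ^+ 2 * (r w * r w `^ sigma).
  apply: le_trans he _; rewrite -mulrA ler_wpM2l//.
  apply: (@le_trans _ _ (Cd ^+ 2 * r w ^+ 2)).
    by rewrite -exprMn ler_sqr ?nnegrE ?enorm_ge0// mulr_ge0.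
  by rewrite ler_wpM2l ?exprn_ge0// sqr_r_le.
have h2 : reg w <= (b1 * L * K + b2) * r w `^ sigma.
  rewrite [leRHS]mulrDl lerD// -!mulrA ler_wpM2l ?(ltW b10)//.
  apply: le_trans zeta_le _; rewrite -mulrA ler_wpM2l// ler_wpM2l//.
  by apply: ger1_powR; [rewrite r_gt0 r_le1|exact: ltW].
have h3 : reg w * enorm p <= (b1 * L * K + b2) * r w `^ sigma * (Cd * r w).
  by apply: ler_pM; rewrite ?enorm_ge0// addr_ge0 ?b2r_ge0// mulr_ge0// ltW.
apply: le_trans (lerD h1 h3) _.
by rewrite le_eqVlt; apply/orP; left; apply/eqP; ring.
Qed.

End Pointwise.

Variables (delta K : R).
Hypothesis delta_gt0 : 0 < delta.
Hypothesis K_ge0 : 0 <= K.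
Hypothesis error_bound : forall w, enorm (w - u0) <= delta -> grad h w != 0 ->
  exists v, [/\ grad h v = 0, psd (hess h v) & enorm (w - v) <= K * r w].
Hypothesis grad_neq0 : \forall k \near \oo, grad h (u k) != 0.

Lemma unit_newton_steps : exists C1 C2, [/\ 0 <= C1, 0 <= C2 &
  \forall k \near \oo, [/\ u k.+1 = u k + d k, enorm (d k) <= C1 * r (u k)
    & r (u k.+1) <= C2 * (r (u k) * r (u k) `^ sigma)]].
Proof.
have L0 := sb_L sm; have rad0 := sb_rho sm.
pose C1 := b1 / (b1 - 1) * K + L * K ^+ 2 / b2 + K.
pose C2 := (b1 * L * K + b2) * C1 + L * C1 ^+ 2.
have b10 : 0 < b1 by rewrite (lt_trans _ b1_gt1).
have C10 : 0 <= C1.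
  rewrite addr_ge0// addr_ge0//.
    by rewrite mulr_ge0// divr_ge0 ?subr_ge0 ?(ltW b10) ?(ltW b1_gt1).
  by rewrite divr_ge0 ?mulr_ge0 ?exprn_ge0 ?(ltW b2_gt0).
have C20 : 0 <= C2.
  rewrite addr_ge0//; last by rewrite mulr_ge0// exprn_ge0.
  by rewrite mulr_ge0// addr_ge0 ?(ltW b2_gt0)// !mulr_ge0// ltW.
exists C1, C2; split => //.
have r20 : 0 < rad / 2 by rewrite divr_gt0.
have b20 : 0 < b2 / 2 by rewrite divr_gt0.
have [e1 e10 he1] := ex_small_mul K r20.
have [e2 e20 he2] := ex_small_mul C1 r20.
have [c c0 hc] := ex_small_mul (L * C1) b20.
have s1 : 0 < 1 - sigma by rewrite subr_gt0.
have [e3 e30 he3] := ex_small_powR s1 c0.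
near=> k.
have ukb2 : enorm (u k - u0) < rad / 2 by near: k; exact: u_cvg.
have ukb : enorm (u k - u0) <= rad by lra.
have ukd : enorm (u k - u0) < delta by near: k; exact: u_cvg.
have g0 : grad h (u k) != 0 by near: k.
have r0 : 0 < r (u k) by rewrite enorm_gt0.
have rlt1 : r (u k) < 1 by near: k; exact: newton_grad_cvg0.
have rlte1 : r (u k) < e1 by near: k; exact: newton_grad_cvg0.
have rlte2 : r (u k) < e2 by near: k; exact: newton_grad_cvg0.
have rlte3 : r (u k) < e3 by near: k; exact: newton_grad_cvg0.
have E : (hess h (u k) + (reg (u k))%:M) *m d k = - grad h (u k) by near: k.
have [mk [amk hmk uE]] : exists mk : nat,
  [/\ armijo (u k) (d k) mk, forall j, (j < mk)%N -> ~~ armijo (u k) (d k) j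
    & u k.+1 = u k + beta ^+ mk *: d k] by near: k.
have [v [v0 vpsd wv]] := error_bound (ltW ukd) g0.
have vb : enorm (v - u0) <= rad.
  have := ler_enorm_dist (u k) v u0; rewrite (enorm_distC v (u k)).
  have : K * r (u k) < rad / 2 by apply: he1; rewrite !ltW.
  lra.
have dC : enorm (d k) <= C1 * r (u k).
  exact: direction_le ukb vb v0 K_ge0 wv E r0 (ltW rlt1).
have wpb : enorm (u k + d k - u0) <= rad.
  rewrite addrAC; apply: le_trans (ler_enormD _ _) _.
  have : C1 * r (u k) < rad / 2 by apply: he2; rewrite !ltW.
  lra.
have arm0 : armijo (u k) (d k) 0.
  apply: unit_step_armijo => //.
  have rE : r (u k) = r (u k) `^ (1 - sigma) * r (u k) `^ sigma.
    by rewrite -powRD ?subrK ?powRr1 ?(ltW r0)// gt_eqF ?implybT.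
  apply: (@le_trans _ _ (L * C1 * r (u k) `^ (1 - sigma) * r (u k) `^ sigma)).
    by rewrite -mulrA -rE -mulrA ler_wpM2l.
  rewrite ler_wpM2r ?powR_ge0// ltW// hc// powR_ge0/=.
  by apply: he3; rewrite !ltW.
have uE' : u k.+1 = u k + d k.
  case: mk amk hmk uE => [|j] _ hmk uE; first by rewrite uE expr0 scale1r.
  by have := hmk 0 (ltn0Sn _); rewrite arm0.
split=> //.
rewrite uE'.
exact: (newton_grad_next ukb vb v0 vpsd K_ge0 wv E r0 (ltW rlt1) wpb).
Unshelve. all: by end_near. Qed.

(* Summing the geometrically decreasing steps bounds the distance to the limit
   by the gradient norm. *)
Theorem local_newton_rate : exists C : R,
  \forall k \near \oo, enorm (u k.+1 - u0) <= C * enorm (u k - u0) `^ (1 + sigma).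
Proof.
have L0 := sb_L sm; have rad0 := sb_rho sm.
have u0b : enorm (u0 - u0) <= rad by rewrite subrr enorm0 ltW.
have [C1 [C2 [C10 C20 hs]]] := unit_newton_steps.
have half0 : (0 : R) < 2^-1 by rewrite invr_gt0.
have [c c0 hc] := ex_small_mul C2 half0.
have [e1 e10 he1] := ex_small_powR sigma_gt0 c0.
have crit : grad h u0 = 0.
  apply/eqP; rewrite -enorm_eq0 eq_le enorm_ge0 andbT.
  apply/ler_addgt0Pr => e e0; rewrite add0r.
  have e2 : 0 < e / 2 by rewrite divr_gt0.
  have [e3 e30 he3] := ex_small_mul L e2.
  have [k _ hk] : \forall k \near \oo, enorm (grad h u0) <= e.
    near=> k.
    have ukb : enorm (u k - u0) < rad by near: k; exact: u_cvg.
    have uk3 : enorm (u k - u0) < e3 by near: k; exact: u_cvg.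
    have rk : r (u k) < e / 2 by near: k; exact: newton_grad_cvg0.
    have := sb_grad_lip sm u0b (ltW ukb).
    have : L * enorm (u k - u0) < e / 2 by apply: he3; rewrite enorm_ge0 ltW.
    have := ler_enormB (grad h (u k)) (grad h (u k) - grad h u0).
    rewrite subKr; lra.
  by apply: (hk k) => /=.
have [N _ hN] : \forall k \near \oo, [/\ enorm (u k.+1 - u k) <= C1 * r (u k),
    r (u k.+1) <= C2 * (r (u k) * r (u k) `^ sigma),
    r (u k.+1) <= r (u k) / 2 & r (u k) <= L * enorm (u k - u0)].
  near=> k.
  have [uE dC rC] : [/\ u k.+1 = u k + d k, enorm (d k) <= C1 * r (u k)
    & r (u k.+1) <= C2 * (r (u k) * r (u k) `^ sigma)] by near: k.
  have re : r (u k) < e1 by near: k; exact: newton_grad_cvg0.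
  have ukb : enorm (u k - u0) < rad by near: k; exact: u_cvg.
  split => //.
  - by rewrite uE addrC addKr.
  - apply: le_trans rC _; rewrite mulrCA ler_wpM2l ?enorm_ge0// ltW// hc//.
    by rewrite powR_ge0/=; apply: he1; rewrite enorm_ge0 ltW.
  - by have := sb_grad_lip sm u0b (ltW ukb); rewrite crit subr0.
have geo k j : (N <= k)%N ->
    enorm (u (k + j)%N - u k) + 2 * C1 * r (u (k + j)%N) <= 2 * C1 * r (u k).
  move=> Nk; elim: j => [|j IH].
    by rewrite addn0 subrr enorm0 add0r.
  have [h1 _ h2 _] := hN (k + j)%N (leq_trans Nk (leq_addr _ _)).
  rewrite addnS; have := ler_enorm_dist (u (k + j)%N) (u (k + j).+1) (u k).
  have : 2 * C1 * r (u (k + j).+1) <= 2 * C1 * (r (u (k + j)%N) / 2).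
    by rewrite ler_wpM2l// mulr_ge0.
  lra.
have dist_le k : (N <= k)%N -> enorm (u k - u0) <= 2 * C1 * r (u k).
  move=> Nk; apply/ler_addgt0Pr => e e0.
  have [N' _ hN'] := u_cvg e0.
  have := hN' (k + N')%N (leq_addl _ _) => /= h1.
  have := geo k N' Nk.
  have : 0 <= 2 * C1 * r (u (k + N')%N) by rewrite !mulr_ge0 ?enorm_ge0.
  have := ler_enorm_dist (u (k + N')%N) (u k) u0.
  rewrite (enorm_distC (u k) (u (k + N')%N)); lra.
exists (2 * C1 * (C2 * (L * L `^ sigma))).
exists N => // k /= Nk.
have [_ h2 _ h3] := hN k Nk.
apply: le_trans (dist_le _ (leqW Nk)) _.
rewrite -!mulrA ler_wpM2l// ler_wpM2l//; apply: le_trans h2 _.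
rewrite ler_wpM2l//.
have E0 := enorm_ge0 (u k - u0).
have s1 : 1 + sigma != 0 by rewrite gt_eqF// addr_gt0.
rewrite powRD; last by rewrite (negbTE s1).
rewrite powRr1// (mulrA (L `^ sigma)) [_ `^ _ * enorm _]mulrC -mulrA mulrA.
rewrite -powRM//.
apply: ler_pM; rewrite ?enorm_ge0 ?powR_ge0//.
by apply: ge0_ler_powR; rewrite ?nnegrE ?enorm_ge0 ?mulr_ge0// ltW.
Unshelve. all: by end_near. Qed.

End LocalNewton.

(** * The proximal step *)

Section Prox.
Context {R : realType}.
Variables (n : nat) (lam q : R).
Hypothesis lam_gt0 : 0 < lam.
Hypothesis q_range : 0 < q < 1.

Lemma lqq_ge0 (x : 'cV[R]_n) : 0 <= lqq q x.
Proof. by apply: sumr_ge0 => i _; exact: powR_ge0. Qed.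

Lemma powR_le_lqq (x : 'cV[R]_n) i : `|x i 0| `^ q <= lqq q x.
Proof.
by rewrite /lqq (bigD1 i)//= lerDl; apply: sumr_ge0 => j _; exact: powR_ge0.
Qed.

Lemma lqq_bounded c : exists r, forall x : 'cV[R]_n, lqq q x <= c -> enorm x <= r.
Proof.
have /andP[q0 q1] := q_range.
exists (\sum_(i < n) c `^ q^-1) => x xc.
apply: le_trans (enorm_le_sum _) _; apply: ler_sum => i _.
have -> : `|x i 0| = (`|x i 0| `^ q) `^ q^-1.
  by rewrite -powRrM mulfV ?gt_eqF// powRr1.
have h := le_trans (powR_le_lqq x i) xc.
apply: ge0_ler_powR; rewrite ?nnegrE ?powR_ge0 ?invr_ge0 ?(ltW q0)//.
by apply: le_trans h; exact: powR_ge0.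
Qed.

Lemma powR_neg_lb (s c : R) : s < 0 -> 0 <= c ->
  exists2 nu, 0 < nu & forall a, 0 < a -> a `^ s <= c -> nu <= a.
Proof.
move=> s0 c0; have c1 : 0 < c + 1 by rewrite ltr_wpDl.
exists ((c + 1) `^ s^-1); first exact: powR_gt0.
move=> a a0 ac; rewrite leNgt; apply/negP => /ltW h.
have := le_powR_npos (ltW s0) a0 h.
rewrite -powRrM mulVf ?lt_eqF// powRr1 ?(ltW c1)//; lra.
Qed.

Lemma prox_coord mu (y z : 'cV[R]_n) i a : prox mu lam q y z ->
  mu / 2 * (z i 0 - y i 0) ^+ 2 + lam * `|z i 0| `^ q <=
  mu / 2 * (a - y i 0) ^+ 2 + lam * `|a| `^ q.
Proof.
pose w : 'cV[R]_n := \col_j if j == i then a else z j 0.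
have S (F G : 'I_n -> R) : (forall j, j != i -> F j = G j) ->
    \sum_j F j = \sum_j G j + (F i - G i).
  move=> FG; rewrite (bigD1 i)//= [in RHS](bigD1 i)//= (eq_bigr _ FG); lra.
move=> /(_ w); rewrite !sqr_enorm /dot /lqq.
rewrite [X in _ <= mu / 2 * X + _](S _ (fun j => (z - y) j 0 * (z - y) j 0)); last first.
  by move=> j ji; rewrite !mxE (negbTE ji).
rewrite [X in _ <= _ + lam * X](S _ (fun j => `|z j 0| `^ q)); last first.
  by move=> j ji; rewrite mxE (negbTE ji).
rewrite !mxE eqxx !mulrDr !expr2; lra.
Qed.

Lemma prox_stationary mu (y z : 'cV[R]_n) i : prox mu lam q y z -> z i 0 != 0 ->
  mu * (z i 0 - y i 0) + lam * (q * Num.sg (z i 0) * `|z i 0| `^ (q - 1)) = 0.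
Proof.
move=> /(@prox_coord _ _ _ i); set a := z i 0; set b := y i 0 => hmin a0.
pose phi (t : R) := mu / 2 * (t - b) ^+ 2 + lam * `|t| `^ q.
have dphi (t : R) : t != 0 ->
    is_derive t 1 phi (mu * (t - b) + lam * (q * Num.sg t * `|t| `^ (q - 1))).
  move=> t0; apply: is_deriveD; last first.
    by have := is_deriveZ lam (is_derive_normr_powR q t0).
  have -> : mu * (t - b) = 2 * (t - b) * (mu / 2) by field.
  move: (is_derive_sqr_mulr (mu / 2) (t - b)); apply: is_derive_line => s.
  by rewrite mulrC addrA.
have an0 : 0 < `|a| by rewrite normr_gt0.
have tn0 t : t \in `]a - `|a|, a + `|a|[ -> t != 0.
  rewrite in_itv/= => /andP[h1 h2]; apply/eqP => t0; rewrite t0 in h1 h2.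
  by have [ha|ha] := lerP 0 a; [rewrite ger0_norm// in h1 h2|rewrite ltr0_norm// in h1 h2];
    lra.
have [_] : is_derive a 1 phi 0.
  apply: (@derive1_at_min R phi (a - `|a|) (a + `|a|)).
  - lra.
  - by move=> t /tn0/dphi[].
  - by rewrite in_itv/=; apply/andP; split; lra.
  - by move=> t _; exact: hmin.
by move=> E; have [_ <-] := dphi _ a0; rewrite E.
Qed.

Lemma prox_threshold mu (y z : 'cV[R]_n) i : prox mu lam q y z -> z i 0 != 0 ->
  lam * (1 - q) * `|z i 0| `^ (q - 2) <= mu / 2.
Proof.
move=> hz z0; have /andP[q0 q1] := q_range.
have st := prox_stationary hz z0.
have := prox_coord i 0 hz; rewrite normr0 powR0 ?gt_eqF// mulr0 addr0 sub0r.
move: st z0; set a := z i 0; set b := y i 0 => st a0 h.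
have an0 : 0 < `|a| by rewrite normr_gt0.
have E1 : a * (lam * (q * Num.sg a * `|a| `^ (q - 1))) = lam * (q * `|a| `^ q).
  rewrite (_ : _ * _ = lam * (q * ((Num.sg a * a) * `|a| `^ (q - 1)))); last by ring.
  by rewrite -normrEsg mulr_powRB1.
have E2 : `|a| `^ q = `|a| `^ (q - 2) * a ^+ 2.
  rewrite -[a ^+ 2]ger0_norm ?sqr_ge0// normrX -powR_mulrn// -powRD ?subrK//.
  by rewrite gt_eqF ?implybT.
have E3 : mu * a * (a - b) = - (lam * (q * `|a| `^ q)).
  rewrite -E1; have := congr1 (fun t => a * t) st; rewrite mulr0 mulrDr; lra.
rewrite -(@ler_pM2r _ (a ^+ 2)); last by rewrite exprn_even_gt0.
rewrite -[lam * _ * _ * _]mulrA -E2; move: h E3; set N := _ `^ q => h E3; nra.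
Qed.

End Prox.

Section ProxGradStep.
Context {R : realType}.
Variables (m n : nat) (f : 'cV[R]_m -> R) (A : 'M[R]_(m, n)) (lam q : R).
Hypothesis lam_gt0 : 0 < lam.
Hypothesis q_range : 0 < q < 1.
Hypothesis f_C2 : twice_continuously_differentiable f.
Hypothesis f_lb : has_lbound (range f).

Lemma level_set_bounded c :
  exists E r, 0 <= E /\ forall x : 'cV[R]_n, objF f A lam q x <= c ->
    lam * lqq q x <= E /\ enorm x <= r.
Proof.
have [cf hcf] := f_lb.
have [r hr] := lqq_bounded n q_range (`|c - cf| / lam).
exists `|c - cf|, r; split => // x hx.
have : cf <= psi f A x by apply: hcf; exists (A *m x).
have := ler_norm (c - cf); rewrite /objF in hx => h1 h2.
have h3 : lam * lqq q x <= `|c - cf| by lra.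
by split => //; apply: hr; rewrite ler_pdivlMr// mulrC.
Qed.

Lemma prox_grad_descent x mu z : 0 < mu ->
  prox mu lam q (x - mu^-1 *: grad (psi f A) x) z ->
  mu / 2 * enorm (z - x) ^+ 2 + dot (grad (psi f A) x) (z - x) + lam * lqq q z
    <= lam * lqq q x.
Proof.
move=> mu0 /(_ x); set g := grad _ _.
have -> : z - (x - mu^-1 *: g) = (z - x) + mu^-1 *: g.
  by rewrite opprB addrA addrAC.
have -> : x - (x - mu^-1 *: g) = mu^-1 *: g by rewrite subKr.
move: (z - x) => p.
rewrite !sqr_enorm !dotDl !dotDr !dotZl !dotZr (dotC p g).
set G := dot g g; set P := dot p p; set I := dot g p.
have -> : mu / 2 * (P + mu^-1 * I + (mu^-1 * I + mu^-1 * (mu^-1 * G))) =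
   mu / 2 * P + I + mu / 2 * (mu^-1 * (mu^-1 * G)) by field; rewrite gt_eqF.
lra.
Qed.

Lemma prox_grad_step_bound c mumin mumax tau alpha :
  0 < mumin -> 1 < tau -> 0 < alpha ->
  exists mubar, forall x mu xb mub, objF f A lam q x <= c ->
    mumin <= mu <= mumax -> prox_grad_step f A lam q tau alpha x mu xb mub ->
    [/\ mumin <= mub <= mubar,
        prox mub lam q (x - mub^-1 *: grad (psi f A) x) xb
      & objF f A lam q xb <= objF f A lam q x - alpha / 2 * enorm (xb - x) ^+ 2].
Proof.
move=> mumin0 tau1 alpha0; have tau0 := lt_trans ltr01 tau1.
have [E [r [E0 hr]]] := level_set_bounded c.
have r1 : exists2 r1, 0 <= r1 & r <= r1 by exists `|r| => //; exact: ler_norm.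
case: r1 => r1 r10 rr1.
have [N0 N00 hN] : exists2 N0, 0 <= N0 &
    forall x, enorm x <= r -> enorm (grad (psi f A) x) <= N0.
  have [_ dg _] := f_C2.
  have [K K0 hK] := enorm_ball_bounded (mxsum A * r1)
    (fun z => differentiable_continuous (dg z)).
  exists (mxsum A^T * (m%:R * K)) => [|x xr].
    by rewrite !mulr_ge0 ?mxsum_ge0.
  rewrite psi_gradE//; apply: le_trans (enorm_mulmx _ _) _.
  rewrite ler_wpM2l ?mxsum_ge0//; apply: le_trans (enorm_le_norm _) _.
  rewrite ler_wpM2l//; apply: hK; apply: le_trans (enorm_mulmx _ _) _.
  by rewrite ler_wpM2l ?mxsum_ge0// (le_trans xr).
pose D := 1 + 2 * (E + N0) / mumin.
have D0 : 0 <= D by rewrite addr_ge0// divr_ge0 ?mulr_ge0 ?addr_ge0// ltW.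
have [M M0 hM] := psi_taylor_bounded A (r1 + D) f_C2.
exists (mumax + tau * (2 * M + alpha)).
move=> x mu xb mub xc /andP[mu1 mu2] [l [xs [hprox hrej hacc [-> ->]]]].
have mu0 : 0 < mu by apply: lt_le_trans mu1.
have mul_min j : mumin <= tau ^+ j * mu.
  apply: le_trans mu1 _; rewrite ler_peMl ?(ltW mu0)//.
  by rewrite exprn_ege1// ltW.
have mumax0 : 0 <= mumax by apply: le_trans mu2; exact: ltW.
split=> //; last exact: hprox.
rewrite mul_min/=; case: l hprox hrej {hacc} => [|l] hprox hrej.
  rewrite expr0 mul1r ler_wpDr// mulr_ge0 ?(ltW tau0)// addr_ge0 ?(ltW alpha0)//.
  by rewrite mulr_ge0.
have nu0 := lt_le_trans mumin0 (mul_min l).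
have := hrej l (ltnSn l); rewrite -ltNge => hl.
have hd := prox_grad_descent nu0 (hprox l (leqnSn l)).
have nm := mul_min l.
rewrite exprS -mulrA; move: (tau ^+ l * mu) (xs l) hl nm nu0 hd => nu z hl nm nu0 hd.
rewrite -[leLHS]add0r lerD// ler_wpM2l ?(ltW tau0)//.
have [hE xr] := hr x xc.
have gN := hN x xr.
have Dz : enorm (z - x) <= D.
  have [h1|h1] := lerP (enorm (z - x)) 1.
    by rewrite (le_trans h1)// lerDl divr_ge0 ?mulr_ge0 ?addr_ge0// ltW.
  have h2 := lqq_ge0 q z; have z0 := lt_trans ltr01 h1.
  have h3 := mulr_ge0 (ltW lam_gt0) h2.
  have := cauchy_schwarz (grad (psi f A) x) (z - x); rewrite ler_norml.
  have : enorm (grad (psi f A) x) * enorm (z - x) <= N0 * enorm (z - x).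
    by rewrite ler_wpM2r ?enorm_ge0.
  move=> h4 /andP[h5 _].
  have h6 : E <= E * enorm (z - x) by rewrite ler_peMr// ltW.
  have h7 : mumin / 2 * enorm (z - x) ^+ 2 <= nu / 2 * enorm (z - x) ^+ 2.
    by rewrite ler_wpM2r ?exprn_ge0 ?enorm_ge0// ler_wpM2r.
  rewrite /D; apply: ler_wpDl => //; rewrite ler_pdivlMr// mulrC.
  rewrite -(ler_pM2r z0); rewrite !expr2 in h7 hd; lra.
have zr : enorm z <= r1 + D.
  rewrite -(subrK x z) addrC; apply: le_trans (ler_enormD _ _) _.
  by rewrite lerD// (le_trans xr).
have xr' : enorm x <= r1 + D by rewrite (le_trans xr)// ler_wpDr.
have := le_trans (ler_norm _) (hM x z xr' zr).
rewrite /objF in hl => ht.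
have z0 : 0 < enorm (z - x) ^+ 2.
  rewrite exprn_gt0// enorm_gt0; apply: contraTneq hl => zx.
  move/eqP: zx; rewrite subr_eq0 => /eqP ->.
  by rewrite subrr enorm0 expr0n/= mulr0 subr0 ltxx.
rewrite -(ler_pM2r z0) ltW//; lra.
Qed.

End ProxGradStep.

(** * Subdifferential and KL inequality *)

Section Support.
Context {R : realType}.

Lemma sum_enum_val n (S : {set 'I_n}) (F : 'I_n -> R) :
  (forall i, i \notin S -> F i = 0) -> \sum_(i < #|S|) F (enum_val i) = \sum_i F i.
Proof.
move=> F0; rewrite -(big_enum_val (A := mem S)) big_mkcond/=; apply: eq_bigr => i _.
by case: ifPn => // /F0 ->.
Qed.

Lemma dot_subvec n (S : {set 'I_n}) (x y : 'cV[R]_n) :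
  (forall i, i \notin S -> x i 0 = 0) -> dot (subvec S x) (subvec S y) = dot x y.
Proof.
move=> x0; rewrite /dot -(@sum_enum_val _ S); last first.
  by move=> i /x0 ->; rewrite mul0r.
by apply: eq_bigr => i _; rewrite !mxE.
Qed.

Lemma enorm_subvec n (S : {set 'I_n}) (x : 'cV[R]_n) :
  (forall i, i \notin S -> x i 0 = 0) -> enorm (subvec S x) = enorm x.
Proof. by move=> x0; rewrite /enorm dot_subvec. Qed.

Lemma subvecD n (S : {set 'I_n}) (x y : 'cV[R]_n) :
  subvec S (x + y) = subvec S x + subvec S y.
Proof. by apply/matrixP => i j; rewrite !mxE. Qed.

Lemma subvecB n (S : {set 'I_n}) (x y : 'cV[R]_n) :
  subvec S (x - y) = subvec S x - subvec S y.
Proof. by apply/matrixP => i j; rewrite !mxE. Qed.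

Lemma subvecZ n (S : {set 'I_n}) a (x : 'cV[R]_n) :
  subvec S (a *: x) = a *: subvec S x.
Proof. by apply/matrixP => i j; rewrite !mxE. Qed.

Lemma supp0 n (x : 'cV[R]_n) i : i \notin supp x -> x i 0 = 0.
Proof. by rewrite inE negbK => /eqP. Qed.

Lemma subvec_supp_neq0 n (x : 'cV[R]_n) i : subvec (supp x) x i 0 != 0.
Proof. by rewrite mxE; have := enum_valP i; rewrite inE. Qed.

Lemma objF_subvec m n (f : 'cV[R]_m -> R) (A : 'M[R]_(m, n)) lam q
    (S : {set 'I_n}) (x : 'cV[R]_n) : q != 0 ->
  (forall i, i \notin S -> x i 0 = 0) ->
  objF f A lam q x = objFS f A lam q S (subvec S x).
Proof.
move=> q0 x0; rewrite /objF /objFS /psi; congr (f _ + lam * _).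
  apply/matrixP => i j; rewrite ord1 !mxE -(@sum_enum_val _ S).
    by apply: eq_bigr => k _; rewrite !mxE.
  by move=> k /x0 ->; rewrite mulr0.
rewrite /lqq -(@sum_enum_val _ S) => [|i /x0 ->]; last by rewrite normr0 powR0.
by apply: eq_bigr => k _; rewrite mxE.
Qed.

Lemma absmin_attained n (x : 'cV[R]_n) : x != 0 ->
  exists2 i, i \in supp x & absmin x = `|x i 0| /\
    forall j, j \in supp x -> absmin x <= `|x j 0|.
Proof.
move=> x0; have [i0 hi0] : exists i, i \in supp x.
  apply/existsP; apply: contraNT x0; rewrite negb_exists => /forallP h.
  by apply/eqP/matrixP => i j; rewrite ord1 mxE; exact/supp0/h.
pose i := [arg min_(i < i0 | i \in supp x) `|x i 0|]%O.
have [iS imin] : i \in supp x /\ forall j, j \in supp x -> `|x i 0| <= `|x j 0|.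
  by rewrite /i; case: arg_minP.
have E : absmin x = `|x i 0|.
  apply/eqP; rewrite eq_le; apply/andP; split.
    by apply: ge_inf; [exists 0 => _ [j _ <-]|exists i].
  by apply: lb_le_inf => [|_ [j jS <-]]; [exists `|x i 0|, i|exact: imin].
by exists i => //; rewrite E.
Qed.

End Support.

Section Subdifferential.
Context {R : realType}.

Lemma is_derive_near (phi : R -> R) (a d e : R) : is_derive a 1 phi d -> 0 < e ->
  exists2 del, 0 < del & forall t, `|t - a| < del ->
    `|phi t - phi a - d * (t - a)| <= e * `|t - a|.
Proof.
move=> [dphi dE] e0.
have : (fun h : R => h^-1 *: ((phi \o shift a) (h *: 1) - phi a)) @ 0^' --> d.
  by rewrite -dE; exact: dphi.
move=> /cvgrPdist_le/(_ _ e0); rewrite near_withinE => /nbhs_ballP[del /= del0 h].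
exists del => // t ta; have [->|ta0] := eqVneq t a.
  by rewrite !subrr mulr0 subrr normr0 mulr0.
have ta0' : t - a != 0 by rewrite subr_eq0.
have := h (t - a); rewrite -ball_normE/= sub0r normrN => /(_ ta ta0').
rewrite [_ *: 1]mulr1 subrK /GRing.scale/= => h1.
have -> : phi t - phi a = (t - a)^-1 * (phi t - phi a) * (t - a).
  by rewrite mulrAC mulVf// mul1r.
by rewrite -mulrBl normrM distrC ler_wpM2r.
Qed.

Lemma concave_tangent (phi : R -> R) (I : set R) s t :
  (forall s t a : R, I s -> I t -> 0 <= a <= 1 ->
     a * phi s + (1 - a) * phi t <= phi (a * s + (1 - a) * t)) ->
  I s -> I t -> derivable phi s 1 ->
  derive1 phi s * (s - t) <= phi s - phi t.
Proof.
move=> conc Is It dphi.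
suff : phi t - phi s <= derive1 phi s * (t - s) by lra.
apply/ler_addgt0Pr => e e0.
have [ts|ts] := eqVneq t s; first by rewrite ts !subrr mulr0 add0r ltW.
have ts0 : 0 < `|t - s| by rewrite normr_gt0 subr_eq0.
have dphi' : is_derive s 1 phi (derive1 phi s) by split=> //; rewrite derive1E.
have ets : 0 < e / `|t - s| by rewrite divr_gt0.
have [del del0 hdel] := is_derive_near dphi' ets.
have [a1 a10 ha1] := ex_small_mul (`|t - s|) del0.
pose a := Num.min a1 1.
have a0 : 0 < a by rewrite lt_min a10 ltr01.
have aa1 : a <= 1 by rewrite ge_min lexx orbT.
have := hdel (a * t + (1 - a) * s).
have -> : a * t + (1 - a) * s - s = a * (t - s) by ring.
rewrite normrM (gtr0_norm a0).
have ha : a * `|t - s| < del by rewrite mulrC ha1// (ltW a0) ge_min lexx.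
move=> /(_ ha) /(le_trans (ler_norm _)) h1.
have h2 := conc t s a It Is; rewrite (ltW a0) aa1 in h2; have {}h2 := h2 isT.
have h3 : e / `|t - s| * (a * `|t - s|) = a * e by field; rewrite gt_eqF.
rewrite h3 in h1; rewrite -(ler_pM2l a0); lra.
Qed.

Variables (m n : nat) (A : 'M[R]_(m, n)) (f : 'cV[R]_m -> R) (lam q : R).
Hypothesis f_C2 : twice_continuously_differentiable f.
Hypothesis lam_gt0 : 0 < lam.
Hypothesis q_range : 0 < q < 1.

(* The gradient of F_S at x_S, extended by 0; off the support of x every vector
   is a regular subgradient of the lq term, since q < 1. *)
Definition supp_grad (x : 'cV[R]_n) : 'cV[R]_n :=
  \col_i if i \in supp x
         then grad (psi f A) x i 0 +
              lam * (q * Num.sg (x i 0) * `|x i 0| `^ (q - 1))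
         else 0.

Lemma subvec_supp_grad (x : 'cV[R]_n) :
  grad (objFS f A lam q (supp x)) (subvec (supp x) x) =
  subvec (supp x) (supp_grad x).
Proof.
have u0 := @subvec_supp_neq0 _ _ x.
rewrite (grad_lq_obj (subcols (supp x) A) lam q f_C2 u0); apply/matrixP => i j.
rewrite ord1 [RHS]mxE [RHS]mxE (enum_valP i) psi_gradE// /comp_grad !mxE.
have -> : subcols (supp x) A *m subvec (supp x) x = A *m x.
  apply/matrixP => k l; rewrite ord1 !mxE -(@sum_enum_val _ _ (supp x)).
    by apply: eq_bigr => o _; rewrite !mxE.
  by move=> o /supp0 ->; rewrite mulr0.
by congr (_ + _); apply: eq_bigr => k _; rewrite !mxE.
Qed.

Lemma enorm_supp_grad (x : 'cV[R]_n) : enorm (supp_grad x) =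
  enorm (grad (objFS f A lam q (supp x)) (subvec (supp x) x)).
Proof.
by rewrite subvec_supp_grad enorm_subvec// => i iS; rewrite mxE (negbTE iS).
Qed.

Lemma lq_term_near (a g e : R) : 0 < e -> exists2 del, 0 < del &
  forall t, `|t - a| < del ->
  lam * `|a| `^ q + (if a != 0 then lam * (q * Num.sg a * `|a| `^ (q - 1)) else g)
    * (t - a) - e * `|t - a| <= lam * `|t| `^ q.
Proof.
have /andP[q0 q1] := q_range.
move=> e0; have [->|a0] /= := eqVneq a 0.
  have q10 : 0 < 1 - q by rewrite subr_gt0.
  have c0 : 0 < lam / (`|g| + 1) by rewrite divr_gt0// ltr_wpDl.
  have [del del0 hdel] := ex_small_powR q10 c0.
  exists del => // t; rewrite subr0 normr0 powR0 ?gt_eqF// mulr0 add0r => td.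
  have := hdel `|t|; rewrite normr_ge0 (ltW td) => /(_ isT).
  rewrite ler_pdivlMr ?ltr_wpDl// => h1.
  have h2 : `|t| = `|t| `^ (1 - q) * `|t| `^ q.
    rewrite -powRD ?subrK ?powRr1//.
    by rewrite ?subrK oner_eq0.
  have h3 : `|t| `^ (1 - q) * (`|g| + 1) * `|t| `^ q <= lam * `|t| `^ q.
    by rewrite ler_wpM2r// powR_ge0.
  have h4 : g * t <= `|g| * `|t| by rewrite -normrM ler_norm.
  have h5 : 0 <= e * `|t| by rewrite mulr_ge0// ltW.
  have h6 : (`|g| + 1) * `|t| <= lam * `|t| `^ q.
    by rewrite [X in _ * X <= _]h2 mulrA (mulrC (`|g| + 1)).
  have := normr_ge0 t; lra.
have el0 : 0 < e / lam by rewrite divr_gt0.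
have [del del0 hdel] := is_derive_near (is_derive_normr_powR q a0) el0.
exists del => // t /hdel; rewrite ler_norml => /andP[h _].
have := ler_wpM2l (ltW lam_gt0) h.
have -> : lam * - (e / lam * `|t - a|) = - (e * `|t - a|).
  by field; rewrite gt_eqF.
lra.
Qed.

Lemma supp_grad_regular (x : 'cV[R]_n) :
  regular_subdiff (fun z => (objF f A lam q z)%:E) x (supp_grad x).
Proof.
split=> // e e0.
have e2 : 0 < e / 2 by rewrite divr_gt0.
have e1 : 0 < e / 2 / n.+1%:R by rewrite divr_gt0.
have /choice[D hD] : forall i : 'I_n, exists del, 0 < del /\
    forall t, `|t - x i 0| < del -> lam * `|x i 0| `^ q +
      (if x i 0 != 0 then lam * (q * Num.sg (x i 0) * `|x i 0| `^ (q - 1))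
       else - grad (psi f A) x i 0) * (t - x i 0) - e / 2 / n.+1%:R * `|t - x i 0|
      <= lam * `|t| `^ q.
  move=> i; have [del del0 h] := lq_term_near (x i 0) (- grad (psi f A) x i 0) e1.
  by exists del.
have [|d1 d10 hd1] := @finite_pos_lb R n D; first by move=> i; case: (hD i).
have [M M0 hM] := psi_taylor_bounded A (enorm x + 1) f_C2.
have [d2 d20 hd2] := ex_small_mul M e2.
apply/near_enormP; exists (Num.min (Num.min d1 d2) 1).
  by rewrite !lt_min d10 d20 ltr01.
move=> y; rewrite !lt_min => /andP[/andP[y1 y2] y3].
rewrite -EFinD lee_fin /objF.
have hpsi : psi f A x + dot (grad (psi f A) x) (y - x) - e / 2 * enorm (y - x)
    <= psi f A y.
  have yr : enorm y <= enorm x + 1.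
    rewrite -(subrK x y) addrC; apply: le_trans (ler_enormD _ _) _.
    by rewrite lerD2l ltW.
  have xr : enorm x <= enorm x + 1 by rewrite lerDl.
  have := hM x y xr yr; rewrite ler_norml => /andP[h _].
  have : M * enorm (y - x) ^+ 2 <= e / 2 * enorm (y - x).
    rewrite expr2 mulrA ler_wpM2r ?enorm_ge0// ltW// hd2//.
    by rewrite enorm_ge0 ltW.
  lra.
pose c i := if x i 0 != 0 then lam * (q * Num.sg (x i 0) * `|x i 0| `^ (q - 1))
            else - grad (psi f A) x i 0.
have dotE : dot (supp_grad x) (y - x) =
    dot (grad (psi f A) x) (y - x) + \sum_i c i * (y i 0 - x i 0).
  rewrite /dot -big_split; apply: eq_bigr => i _.
  rewrite [supp_grad x i 0]mxE [(y - x) i 0]mxE [(- x) i 0]mxE inE /c.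
  by case: eqP => _ /=; ring.
have hsum : lam * lqq q x + \sum_i c i * (y i 0 - x i 0)
    - e / 2 * enorm (y - x) <= lam * lqq q y.
  apply: (@le_trans _ _ (\sum_i (lam * `|x i 0| `^ q + c i * (y i 0 - x i 0)
      - e / 2 / n.+1%:R * enorm (y - x)))).
    rewrite sumrB big_split/= -mulr_sumr /lqq lerD2l lerN2.
    rewrite sumr_const card_ord -[leLHS]mulr_natr.
    rewrite (_ : _ * n%:R = e / 2 * enorm (y - x) * (n%:R / n.+1%:R)); last by ring.
    apply: ler_piMr; first by rewrite mulr_ge0 ?(ltW e2) ?enorm_ge0.
    by rewrite ler_pdivrMr// mul1r ler_nat.
  rewrite /lqq mulr_sumr; apply: ler_sum => i _.
  have yi : `|y i 0 - x i 0| <= enorm (y - x).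
    by have := coord_le_enorm (y - x) i; rewrite !mxE.
  have [_ /(_ (y i 0))] := hD i.
  move=> /(_ (le_lt_trans yi (lt_le_trans y1 (hd1 i)))).
  apply: le_trans; rewrite lerB// ler_wpM2l// ltW//.
by rewrite dotE; lra.
Qed.

Lemma supp_grad_limiting (x : 'cV[R]_n) :
  limiting_subdiff (fun z => (objF f A lam q z)%:E) x (supp_grad x).
Proof.
split=> //; exists (fun=> x), (fun=> supp_grad x); split.
- exact: cvg_cst.
- exact: cvg_cst.
- by move=> _; exact: supp_grad_regular.
- exact: cvg_cst.
Qed.

Lemma KL_descent (xs : 'cV[R]_n) : KL_function (fun z => (objF f A lam q z)%:E) ->
  exists (eta rad : R) (phi : R -> R), [/\ 0 < eta, 0 < rad,
    forall s, 0 <= s < eta -> 0 <= phi s,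
    forall e, 0 < e -> exists2 del, 0 < del & forall s, 0 <= s < del -> phi s < e
  & forall x t, enorm (x - xs) < rad -> 
      0 < objF f A lam q x - objF f A lam q xs < eta ->
      0 <= t <= objF f A lam q x - objF f A lam q xs ->
      objF f A lam q x - objF f A lam q xs - t <=
      (phi (objF f A lam q x - objF f A lam q xs) - phi t) *
      enorm (grad (objFS f A lam q (supp x)) (subvec (supp x) x))].
Proof.
set F := objF f A lam q.
move=> KL; have [eta [U [phi]]] : KL_property (fun z => (F z)%:E) xs.
  by apply: KL; exists (supp_grad xs); exact: supp_grad_limiting.
set I := [set s : R | 0 <= s /\ (s%:E < eta)%E].
move=> [[eta0 /near_enormP[r1 r10 hU]] [phi0 phic phiconc phi00] dphi hKL].
have [e1 e10 he1] : exists2 e1 : R, 0 < e1 & (e1%:E <= eta)%E.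
  move: eta0; case: (eta) => [y|_|]//.
    by rewrite lte_fin => y0; exists y.
  by exists 1 => //; rewrite leey.
have hI s : 0 <= s < e1 -> I s.
  move=> /andP[s0 s1]; split => //.
  by apply: lt_le_trans he1; rewrite lte_fin.
exists e1, r1, phi; split => //.
- by move=> s /hI; exact: phi0.
- move=> e e0.
  have I0 : I 0 by apply: hI; rewrite lexx e10.
  have /subspace_continuousP/(_ 0 I0)/cvgrPdist_lt/(_ e e0) := phic.
  rewrite near_withinE => /nbhs_ballP[del /= del0 h].
  exists (Num.min del e1); first by rewrite lt_min del0.
  move=> s; rewrite lt_min => /andP[s0 /andP[sd se]].
  have := h s; rewrite -ball_normE/= sub0r normrN ger0_norm// => /(_ sd).
  have Is : I s by apply: hI; rewrite s0.
  move=> /(_ Is) hh; have {}hh : `|phi 0 - phi s| < e by exact: hh.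
  by rewrite phi00 sub0r normrN in hh; exact: le_lt_trans (ler_norm _) hh.
move=> x t xr /andP[s0 s1] /andP[t0 ts]; set s := F x - F xs in s0 s1 ts *.
have Is : I s by apply: hI; rewrite (ltW s0).
have It : I t by apply: hI; rewrite t0 (le_lt_trans ts).
have [dp _ dpos] := dphi s s0 (proj2 Is).
have tang := concave_tangent phiconc Is It dp.
have := hKL x (hU _ xr); rewrite lte_fin -subr_gt0 => /(_ s0).
have h1 : ((F x)%:E < (F xs)%:E + eta)%E.
  have := proj2 Is; rewrite /s EFinB lteBlDr// addeC.
  exact.
move=> /(_ h1); rewrite -EFinB/= -/s.
set G := enorm _ => hd.
have : (1 <= (derive1 phi s)%:E * G%:E)%E.
  apply: le_trans hd _; rewrite lee_pmul2l// ?lte_fin//.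
  rewrite /dist; apply: ge_ereal_inf.
  exists (enorm (0 - supp_grad x))%:E; first by exists (supp_grad x) => //; exact: supp_grad_limiting.
  by rewrite sub0r enormN enorm_supp_grad.
rewrite -EFinM lee_fin => h2.
have G0 : 0 <= G by exact: enorm_ge0.
have st : 0 <= s - t by rewrite subr_ge0.
have h3 : (s - t) * 1 <= (s - t) * (derive1 phi s * G) by rewrite ler_wpM2l.
have h4 : derive1 phi s * (s - t) * G <= (phi s - phi t) * G by rewrite ler_wpM2r.
lra.
Qed.

End Subdifferential.

(** * Global convergence of the iterates *)

Section Run.
Context {R : realType}.
Variables (m n : nat) (A : 'M[R]_(m, n)).
Variables (f : 'cV[R]_m -> R) (lam q : R) (P : hpg_param R).
Variables (x xb d : nat -> 'cV[R]_n) (mu mub : nat -> R).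
Hypothesis f_C2 : twice_continuously_differentiable f.
Hypothesis f_lb : has_lbound (range f).
Hypothesis lam_gt0 : 0 < lam.
Hypothesis q_range : 0 < q < 1.
Hypothesis P_valid : hpg_param_valid P.
Hypothesis x_hpg : HpgSRN f A lam q P x xb d mu mub.
Hypothesis ratio_liminf :
  (0 < limf_einf (fun k => (descent_ratio f A lam q (x k) (d k))%:E)
         (within (K2 lam q x xb mub) \oo))%E.

Local Notation F z := (objF f A lam q z).
Local Notation FS S := (objFS f A lam q S).
Local Notation K2 := (K2 lam q x xb mub).
Local Notation g z := (grad (FS (supp z)) (subvec (supp z) z)).

Lemma hess_FS_sym (S : {set 'I_n}) (u : 'cV[R]_#|S|) : (forall i, u i 0 != 0) ->
  (hess (FS S) u)^T = hess (FS S) u.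
Proof.
move=> u0; rewrite (hess_lq_obj (subcols S A) lam q f_C2 u0) linearD/=.
by rewrite tr_diag_mx tr_comp_hess.
Qed.

(* No smoothness constant enters here, so these bounds hold before the entries of
   the iterates are known to stay away from zero. *)
Lemma newton_step_facts z p z' (S := supp z) (r := grad (FS S) (subvec S z)) :
  newton_step f A lam q P z p z' ->
  [/\ forall i, i \notin S -> p i 0 = 0,
      exists2 t, 0 < t <= 1 & z' = z + t *: p /\
        F z' <= F z + hpg_rho P * t * dot r (subvec S p),
      0 <= - dot r (subvec S p)
    & hpg_b2 P * enorm r `^ hpg_sigma P * enorm p <= enorm r].
Proof.
have /andP[q0 _] := q_range.
case=> E p0 [mk [arm _ z'E]]; rewrite -/S -/r in E p0 arm *.
have /andP[beta0 beta1] := hpg_beta_range P_valid.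
have sym := hess_FS_sym (@subvec_supp_neq0 _ _ z).
have s0 : 0 <= hpg_b2 P * enorm r `^ hpg_sigma P.
  by rewrite mulr_ge0 ?powR_ge0// ltW// (hpg_b2_gt0 P_valid).
split => //.
- exists (hpg_beta P ^+ mk).
    by rewrite exprn_gt0// exprn_ile1// ltW.
  split => //; rewrite (@objF_subvec _ _ _ _ _ _ _ S z') ?gt_eqF//; last first.
    by move=> i iS; rewrite z'E !mxE p0// mulr0 addr0 supp0.
  rewrite (@objF_subvec _ _ _ _ _ _ _ S z) ?gt_eqF//; last exact: supp0.
  by rewrite z'E subvecD subvecZ.
- apply: le_trans (newton_descent sym (hpg_b1_gt1 P_valid) E s0).
  by rewrite mulr_ge0// exprn_ge0// enorm_ge0.
- rewrite -(enorm_subvec p0).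
  exact: (newton_norm sym (hpg_b1_gt1 P_valid) E s0).
Qed.

Lemma prox_grad_accept z nu zb nub :
  prox_grad_step f A lam q (hpg_tau P) (hpg_alpha P) z nu zb nub ->
  F zb <= F z - hpg_alpha P / 2 * enorm (zb - z) ^+ 2.
Proof. by case=> l [xs [_ _ acc [-> _]]]. Qed.

Lemma objF_nonincreasing : nonincreasing_seq (fun k => F (x k)).
Proof.
apply/nonincreasing_seqP => k.
have [k2|k1] := pselect (K2 k).
  have [_ [t /andP[t0 _] [_ h]] h0 _] := newton_step_facts (hpg_step2 x_hpg k2).
  apply: le_trans h _; rewrite gerDl -oppr_ge0 -mulrN.
  have /andP[rho0 _] := hpg_rho_range P_valid.
  by rewrite mulr_ge0// mulr_ge0 ?ltW.
rewrite (hpg_step1 x_hpg k1).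
apply: le_trans (prox_grad_accept (hpg_prox x_hpg k)) _.
rewrite gerBl mulr_ge0 ?exprn_ge0 ?enorm_ge0//.
by rewrite divr_ge0// ltW// (hpg_alpha_gt0 P_valid).
Qed.

Lemma objF_le0 k : F (x k) <= F (x 0%N).
Proof. exact: objF_nonincreasing. Qed.

Lemma objF_cvg : exists2 Fs, (forall k, Fs <= F (x k)) &
  forall e, 0 < e -> \forall k \near \oo, F (x k) < Fs + e.
Proof.
have lb : has_lbound (range (fun k => F (x k))).
  have [c hc] := f_lb; exists c => _ [k _ <-].
  rewrite ler_wpDr// ?mulr_ge0 ?lqq_ge0 ?(ltW lam_gt0)//.
  by apply: hc; exists (A *m x k).
have cvgF := nonincreasing_cvgn objF_nonincreasing lb.
eexists; first by move=> k; apply: ge_inf; [exact: lb|exists k].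
move=> e e0; move/cvgrPdist_lt: cvgF => /(_ e e0); apply: filterS => k /=.
by rewrite ltr_distlC => /andP[].
Qed.

Lemma objF_diff_cvg0 e : 0 < e -> \forall k \near \oo, F (x k) - F (x k.+1) < e.
Proof.
move=> e0; have [Fs Fs_le /(_ _ e0)] := objF_cvg; apply: filterS => k.
have := Fs_le k.+1; lra.
Qed.

Lemma ratio_near : exists2 c, 0 < c & \forall k \near \oo, K2 k ->
  [/\ 0 < enorm (g (x k)), 0 < enorm (d k)
    & c * (enorm (g (x k)) * enorm (d k)) <=
      - dot (g (x k)) (subvec (supp (x k)) (d k))].
Proof.
move: ratio_liminf; rewrite limf_einfE => /ereal_sup_gt[_ [V hV <-]] V0.
have [c c0 cV] : exists2 c : R, 0 < c &
    (c%:E <= ereal_inf ((fun k => (descent_ratio f A lam q (x k) (d k))%:E) @` V))%E.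
  move: V0; case: (ereal_inf _) => [y|_|]//.
    by rewrite lte_fin => y0; exists y.
  by exists 1 => //; rewrite leey.
exists c => //.
have hV' : \forall k \near \oo, K2 k -> V k by exact: hV.
near=> k.
move=> k2; set S := supp (x k); set r := grad _ _.
have Vk : V k by move: k2; near: k.
have : c <= descent_ratio f A lam q (x k) (d k).
  by rewrite -lee_fin; apply: le_trans cV _; apply: ereal_inf_lbound; exists k.
rewrite /descent_ratio -/S -/r.
have [d0 _ _ _] := newton_step_facts (hpg_step2 x_hpg k2).
rewrite (enorm_subvec d0) => hc.
have h0 : 0 <= enorm r * enorm (d k) by rewrite mulr_ge0 ?enorm_ge0.
have hp : 0 < enorm r * enorm (d k).
  rewrite lt_def h0 andbT; apply: contraTneq hc => ->.
  by rewrite invr0 mulr0 -ltNge.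
split; last by rewrite -ler_pdivlMr.
  by rewrite lt_def enorm_ge0 andbT; apply: contraTneq hp => ->; rewrite mul0r ltxx.
by rewrite lt_def enorm_ge0 andbT; apply: contraTneq hp => ->; rewrite mulr0 ltxx.
Unshelve. all: by end_near. Qed.

Lemma step_cvg0 e : 0 < e -> \forall k \near \oo, enorm (x k.+1 - x k) < e.
Proof.
move=> e0; have [c c0 hc] := ratio_near.
have /andP[rho0 _] := hpg_rho_range P_valid.
have alpha0 := hpg_alpha_gt0 P_valid.
have b20 := hpg_b2_gt0 P_valid.
have /andP[sg0 sg12] := hpg_sigma_range P_valid.
have s1 : 0 < 1 - hpg_sigma P by lra.
pose eta := (hpg_b2 P * e) `^ (1 - hpg_sigma P)^-1.
have eta0 : 0 < eta by rewrite powR_gt0 ?mulr_gt0.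
have h1 : 0 < hpg_alpha P / 2 * e ^+ 2 by rewrite mulr_gt0 ?exprn_gt0 ?divr_gt0.
have h2 : 0 < hpg_rho P * (c * (eta * e)) by rewrite !mulr_gt0.
near=> k.
have d1 : F (x k) - F (x k.+1) < hpg_alpha P / 2 * e ^+ 2.
  by near: k; exact: objF_diff_cvg0.
have d2 : F (x k) - F (x k.+1) < hpg_rho P * (c * (eta * e)).
  by near: k; exact: objF_diff_cvg0.
rewrite ltNge; apply/negP => he.
have [k2|k1] := pselect (K2 k); last first.
  have := prox_grad_accept (hpg_prox x_hpg k).
  rewrite -(hpg_step1 x_hpg k1).
  have : hpg_alpha P / 2 * e ^+ 2 <= hpg_alpha P / 2 * enorm (x k.+1 - x k) ^+ 2.
    rewrite ler_wpM2l ?divr_ge0 ?(ltW alpha0)//.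
    by rewrite ler_sqr ?nnegrE ?enorm_ge0 ?(ltW e0).
  lra.
have [_ [t /andP[t0 t1] [xE h]] _ hd] := newton_step_facts (hpg_step2 x_hpg k2).
have [r0 d0 hr] : [/\ 0 < enorm (g (x k)), 0 < enorm (d k)
    & c * (enorm (g (x k)) * enorm (d k)) <=
      - dot (g (x k)) (subvec (supp (x k)) (d k))].
  by move: k2; near: k.
move: he; rewrite xE addrC addKr enormZ gtr0_norm// => he.
move: r0 hr hd h; set r := grad _ _ => r0 hr hd h.
have ed : e <= enorm (d k).
  by apply: le_trans he _; rewrite ler_piMl ?enorm_ge0.
have etar : eta <= enorm r.
  have rE : enorm r = (enorm r `^ (1 - hpg_sigma P)) `^ (1 - hpg_sigma P)^-1.
    by rewrite -powRrM mulfV ?gt_eqF// powRr1// enorm_ge0.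
  rewrite rE; apply: ge0_ler_powR.
  - by rewrite invr_ge0 ltW.
  - by rewrite nnegrE mulr_ge0// ltW.
  - by rewrite nnegrE powR_ge0.
  rewrite -(ler_pM2r (powR_gt0 (hpg_sigma P) r0)) -powRD; last first.
    by rewrite (gt_eqF r0) implybT.
  rewrite subrK powRr1 ?enorm_ge0//; apply: le_trans hd.
  rewrite mulrAC ler_wpM2l// mulr_ge0 ?powR_ge0//; exact: ltW.
have h3 : hpg_rho P * (c * (eta * e)) <=
    hpg_rho P * (c * (enorm r * (t * enorm (d k)))).
  rewrite ler_wpM2l ?(ltW rho0)// ler_wpM2l ?(ltW c0)//.
  by apply: ler_pM => //; exact: ltW.
have h4 : hpg_rho P * t * (c * (enorm r * enorm (d k))) <=
    hpg_rho P * t * - dot r (subvec (supp (x k)) (d k)).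
  by rewrite ler_wpM2l// mulr_ge0// ltW.
have h5 : hpg_rho P * (c * (enorm r * (t * enorm (d k)))) =
  hpg_rho P * t * (c * (enorm r * enorm (d k))) by ring.
lra.
Unshelve. all: by end_near. Qed.

Lemma run_prox_bounds : exists mubar, forall k,
  [/\ hpg_mumin P <= mub k <= mubar,
      prox (mub k) lam q (x k - (mub k)^-1 *: grad (psi f A) (x k)) (xb k)
    & F (xb k) <= F (x k) - hpg_alpha P / 2 * enorm (xb k - x k) ^+ 2].
Proof.
have [mubar h] := prox_grad_step_bound A lam_gt0 q_range f_C2 f_lb (F (x 0%N))
  (hpg_mumax P) (hpg_mumin_gt0 P_valid) (hpg_tau_gt1 P_valid)
  (hpg_alpha_gt0 P_valid).
by exists mubar => k; apply: h; [exact: objF_le0|exact: (hpg_mu x_hpg)|exact: (hpg_prox x_hpg)].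
Qed.

Lemma mub_gt0 k : 0 < mub k.
Proof.
have [mubar /(_ k)[/andP[h _] _ _]] := run_prox_bounds.
exact: lt_le_trans (hpg_mumin_gt0 P_valid) h.
Qed.

Lemma xb_threshold k i : xb k i 0 != 0 ->
  lam * (1 - q) * `|xb k i 0| `^ (q - 2) <= mub k / 2.
Proof.
have [mubar /(_ k)[_ h _]] := run_prox_bounds.
exact: (prox_threshold q_range h).
Qed.

Lemma same_sign_neq0 k : (forall i, Num.sg (x k i 0) = Num.sg (xb k i 0)) ->
  x k != 0 /\ xb k != 0.
Proof.
move=> h; have ne := hpg_no_stop x_hpg (k := k).
have E : x k = 0 <-> xb k = 0.
  split=> E; apply/matrixP => i j; rewrite ord1 mxE; apply/eqP.
    by rewrite -sgr_eq0 -h E mxE sgr0.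
  by rewrite -sgr_eq0 h E mxE sgr0.
split; apply/eqP => E'; apply: ne; first by rewrite E'; apply/esym/E.
by rewrite E'; apply/E.
Qed.

Lemma newton_iterate_lb : exists2 nu, 0 < nu & forall k i,
  (K2 k -> i \in supp (x k) -> nu <= `|x k i 0|) /\
  (i \in supp (xb k) -> nu <= `|xb k i 0|).
Proof.
have /andP[q0 q1] := q_range.
have [mubar hmu] := run_prox_bounds.
have mubar0 : 0 <= mubar.
  have [/andP[h1 h2] _ _] := hmu 0%N; apply: le_trans h2.
  exact/ltW/mub_gt0.
have q20 : q - 2 < 0 by lra.
have lq0 : 0 < lam * (q * (1 - q)) by rewrite !mulr_gt0// subr_gt0.
have [|nu nu0 hnu] := @powR_neg_lb R (q - 2) (mubar / (lam * (q * (1 - q)))) q20.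
  by rewrite divr_ge0// ltW.
exists nu => // k i; have [/andP[_ h2] _ _] := hmu k.
have mk0 := mub_gt0 k.
have xbi j : xb k j 0 != 0 -> lam * (q * (1 - q)) * `|xb k j 0| `^ (q - 2) <= q * (mub k / 2).
  move=> j0; rewrite mulrCA -mulrA ler_wpM2l ?(ltW q0)//.
  by rewrite xb_threshold.
have qmu : q * (mub k / 2) <= mub k / 2 by rewrite ler_piMl ?ltW// divr_gt0.
split=> [[hsg htest] iS|iS]; last first.
  rewrite inE in iS; apply: hnu; first by rewrite normr_gt0.
  rewrite ler_pdivlMr// mulrC; apply: le_trans (xbi _ iS) _; lra.
have [xk0 xbk0] := same_sign_neq0 hsg.
have [j jS [Ej jmin]] := absmin_attained xk0.
have [l lS [El _]] := absmin_attained xbk0.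
apply: le_trans (jmin i iS); rewrite Ej inE in jS *.
apply: hnu; first by rewrite normr_gt0.
rewrite ler_pdivlMr// mulrC.
move: htest; rewrite Ej El inE in lS *.
have := xbi l lS.
have -> : lam * q * (q - 1) = - (lam * (q * (1 - q))) by ring.
rewrite !mulNr; lra.
Qed.

Lemma support_stabilizes : exists (S : {set 'I_n}) nu, 0 < nu /\
  \forall k \near \oo, [/\ supp (x k) = S, forall i, i \in S -> nu <= `|x k i 0|
    & forall i, Num.sg (x k.+1 i 0) = Num.sg (x k i 0)].
Proof.
have [nu nu0 hnu] := newton_iterate_lb.
have nu4 : 0 < nu / 4 by rewrite divr_gt0.
have [N1 _ hN1] := step_cvg0 nu4.
have hx i k : (N1 <= k)%N -> `|x k.+1 i 0 - x k i 0| < nu / 4.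
  move=> /hN1; apply: le_lt_trans.
  by have := coord_le_enorm (x k.+1 - x k) i; rewrite !mxE.
have hlb k i : (N1 <= k)%N -> x k.+1 i 0 != 0 -> nu / 2 <= `|x k.+1 i 0|.
  move=> Nk xi0; have [k2|k1] := pselect (K2 k); last first.
    move: xi0; rewrite (hpg_step1 x_hpg k1) => xi0.
    have [_ h] := hnu k i; have := h _; rewrite inE xi0 => /(_ isT).
    lra.
  have [d0 [t _ [xE _]] _ _] := newton_step_facts (hpg_step2 x_hpg k2).
  have iS : i \in supp (x k).
    by apply: contraNT xi0 => iS; rewrite xE !mxE d0// supp0// mulr0 addr0.
  have [/(_ k2 iS) h _] := hnu k i.
  have := hx i k Nk; rewrite distrC => h1.
  have := ler_normB (x k.+1 i 0) (x k.+1 i 0 - x k i 0).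
  by rewrite subKr distrC; lra.
have hsg k i : (N1 < k)%N -> Num.sg (x k.+1 i 0) = Num.sg (x k i 0).
  case: k => // k Nk; have h1 := hx i k.+1 (leqW Nk).
  have [E0|x0] := eqVneq (x k.+1 i 0) 0.
    rewrite E0; have [->//|x2] := eqVneq (x k.+2 i 0) 0.
    have := hlb k.+1 i (leqW Nk) x2; move: h1; rewrite E0 subr0; lra.
  have h2 := hlb k i Nk x0.
  move: h1; rewrite ltr_distl => /andP[h3 h4].
  have [xp|xn] := ltrP 0 (x k.+1 i 0).
    by rewrite gtr0_norm// in h2; rewrite !gtr0_sg//; lra.
  have xn' : x k.+1 i 0 < 0 by rewrite lt_neqAle x0.
  by rewrite ltr0_norm// in h2; rewrite !ltr0_sg//; lra.
exists (supp (x N1.+1)), (nu / 2); split; first by rewrite divr_gt0.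
have hS k : (N1 < k)%N -> supp (x k) = supp (x N1.+1).
  elim: k => // k IH; rewrite ltnS leq_eqVlt => /predU1P[->//|Nk].
  rewrite -(IH Nk); apply/setP => i.
  by rewrite !inE -!(sgr_eq0 (_ i 0)) hsg.
exists N1.+1 => // k /= Nk; split; [exact: hS|move=> i|by move=> i; exact: hsg].
rewrite -(hS _ Nk) inE; case: k Nk => // k Nk; exact: hlb.
Qed.

(* At a Step 1 iterate the prox optimality condition expresses the gradient of
   F_S at x^k through x^(k+1) - x^k. *)
Lemma prox_step_grad_bound (xs : 'cV[R]_n) : exists rad C, [/\ 0 < rad, 0 < C &
  forall k, ~ K2 k -> supp (x k) = supp xs -> 
    (forall i, Num.sg (x k.+1 i 0) = Num.sg (x k i 0)) ->
    enorm (x k - xs) < rad -> enorm (x k.+1 - xs) < rad ->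
    enorm (g (x k)) <= C * enorm (x k.+1 - x k)].
Proof.
have /andP[q0 q1] := q_range.
have [mubar hmu] := run_prox_bounds.
have mk0 k := mub_gt0 k.
have mubar0 : 0 <= mubar.
  by have [/andP[_ h2] _ _] := hmu 0%N; apply: le_trans h2; exact: ltW.
have q11 : q - 1 <= 1 by lra.
have /choice[Ls hLs] : forall i : 'I_n, exists L, 0 <= L /\ (xs i 0 != 0 ->
    forall a b, `|a - xs i 0| <= `|xs i 0| / 2 ->
      `|b - xs i 0| <= `|xs i 0| / 2 ->
      `| `|a| `^ (q - 1) - `|b| `^ (q - 1)| <= L * `|a - b|).
  move=> i; have [->|xi0] := eqVneq (xs i 0) 0; first by exists 0.
  by have [L L0 hL] := normr_powR_lipschitz q11 xi0; exists L.
have [|rad rad0 hrad] := @finite_pos_lb R n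
  (fun i => if xs i 0 == 0 then 1 else `|xs i 0| / 2).
  by move=> i; case: eqVneq => // xi0; rewrite divr_gt0// normr_gt0.
pose C := \sum_(i < n) (mubar + lam * q * Ls i) + 1.
have Ci0 i : 0 <= mubar + lam * q * Ls i.
  have [Li0 _] := hLs i.
  by rewrite addr_ge0// mulr_ge0// mulr_ge0// ltW.
have C0 : 0 < C by rewrite ltr_wpDl// sumr_ge0.
exists rad, C; split => // k k1 hS hsg xr xr'.
rewrite -enorm_supp_grad//; apply: le_trans (enorm_le_sum _) _.
rewrite mulrDl mul1r ler_wpDr ?enorm_ge0// mulr_suml; apply: ler_sum => i _.
rewrite mxE; case: ifPn => iS; last first.
  by rewrite normr0 mulr_ge0// enorm_ge0.
have xsi : xs i 0 != 0 by rewrite hS inE in iS.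
have xki : x k i 0 != 0 by rewrite inE in iS.
have xki' : x k.+1 i 0 != 0 by rewrite -sgr_eq0 hsg sgr_eq0.
have close z : enorm (z - xs) < rad -> `|z i 0 - xs i 0| <= `|xs i 0| / 2.
  move=> /ltW hz; have := coord_le_enorm (z - xs) i; rewrite !mxE.
  move=> /le_trans; apply; apply: le_trans hz _.
  by have := hrad i; rewrite (negbTE xsi).
have [/andP[_ mle] hprox _] := hmu k.
have := prox_stationary hprox; rewrite -(hpg_step1 x_hpg k1) => /(_ i xki').
set y := x k - _ *: _; have -> : y i 0 = x k i 0 - (mub k)^-1 * grad (psi f A) (x k) i 0.
  by rewrite /y [LHS]mxE [X in _ + X]mxE [X in _ - X]mxE.
set G := grad (psi f A) (x k) i 0 => st.
have {}st : mub k * (x k.+1 i 0 - x k i 0) + G +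
    lam * (q * Num.sg (x k i 0) * `|x k.+1 i 0| `^ (q - 1)) = 0.
  have muG : mub k * ((mub k)^-1 * G) = G.
    by rewrite mulrA mulfV ?mul1r// gt_eqF.
  by rewrite -[RHS]st hsg -{1}muG; ring.
have -> : G + lam * (q * Num.sg (x k i 0) * `|x k i 0| `^ (q - 1)) =
    - (mub k * (x k.+1 i 0 - x k i 0)) +
    lam * q * (Num.sg (x k i 0) * (`|x k i 0| `^ (q - 1) - `|x k.+1 i 0| `^ (q - 1))).
  by have -> : G = - (mub k * (x k.+1 i 0 - x k i 0)) -
    lam * (q * Num.sg (x k i 0) * `|x k.+1 i 0| `^ (q - 1)) by [lra]; ring.
have Di : `|x k.+1 i 0 - x k i 0| <= enorm (x k.+1 - x k).
  by have := coord_le_enorm (x k.+1 - x k) i; rewrite !mxE.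
apply: le_trans (ler_normD _ _) _; rewrite normrN mulrDl lerD//.
  rewrite normrM (gtr0_norm (mk0 k)); apply: ler_pM => //; exact: ltW.
rewrite !normrM normr_sg xki mul1r (gtr0_norm lam_gt0) (gtr0_norm q0).
rewrite -[X in _ <= X]mulrA ler_wpM2l ?mulr_ge0 ?(ltW q0) ?(ltW lam_gt0)//.
have [Li0 /(_ xsi _ _ (close _ xr) (close _ xr'))] := hLs i.
by move=> /le_trans; apply; rewrite distrC ler_wpM2l.
Qed.

Lemma step_decrease (xs : 'cV[R]_n) :
  (\forall k \near \oo, supp (x k) = supp xs /\
    forall i, Num.sg (x k.+1 i 0) = Num.sg (x k i 0)) ->
  exists rad c, [/\ 0 < rad, 0 < c & \forall k \near \oo,
    F (x k.+1) < F (x k) /\ (enorm (x k - xs) < rad ->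
    c * (enorm (x k.+1 - x k) * enorm (g (x k))) <= F (x k) - F (x k.+1))].
Proof.
move=> hS.
have [rad [C [rad0 C0 hC]]] := prox_step_grad_bound xs.
have [c c0 hc] := ratio_near.
have /andP[rho0 _] := hpg_rho_range P_valid.
have alpha0 := hpg_alpha_gt0 P_valid.
have rad2 : 0 < rad / 2 by rewrite divr_gt0.
pose c1 := Num.min (hpg_rho P * c) (hpg_alpha P / 2 / C).
exists (rad / 2), c1; split => //.
  by rewrite lt_min mulr_gt0//= !divr_gt0.
near=> k.
have dx : enorm (x k.+1 - x k) < rad / 2.
  by near: k; exact: step_cvg0 rad2.
have [Sk sgk] : supp (x k) = supp xs /\
    forall i, Num.sg (x k.+1 i 0) = Num.sg (x k i 0) by near: k.
have h0 : 0 <= enorm (x k.+1 - x k) * enorm (g (x k)).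
  by rewrite mulr_ge0 ?enorm_ge0.
have [k2|k1] := pselect (K2 k).
  have [_ [t /andP[t0 _] [xE h]] _ _] :=
    newton_step_facts (hpg_step2 x_hpg k2).
  have [r0 d0 hr] : [/\ 0 < enorm (g (x k)), 0 < enorm (d k)
    & c * (enorm (g (x k)) * enorm (d k)) <= - dot (g (x k)) (subvec (supp (x k)) (d k))].
    by move: k2; near: k.
  have rt : 0 < hpg_rho P * t by rewrite mulr_gt0.
  have h1 := ler_wpM2l (ltW rt) hr.
  have h2 : 0 < hpg_rho P * t * (c * (enorm (g (x k)) * enorm (d k))).
    by rewrite !mulr_gt0.
  split; first by rewrite mulrN in h1; lra.
  move=> _; have dE : enorm (x k.+1 - x k) = t * enorm (d k).
    by rewrite xE addrC addKr enormZ gtr0_norm.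
  apply: (@le_trans _ _ (hpg_rho P * c * (enorm (x k.+1 - x k) * enorm (g (x k))))).
    by rewrite ler_wpM2r// ge_min lexx.
  rewrite dE (_ : hpg_rho P * c * _ =
    hpg_rho P * t * (c * (enorm (g (x k)) * enorm (d k)))); last by ring.
  rewrite mulrN in h1; lra.
have acc := prox_grad_accept (hpg_prox x_hpg k).
rewrite -(hpg_step1 x_hpg k1) in acc.
have a2 : 0 < hpg_alpha P / 2 by rewrite divr_gt0.
have dn : 0 < enorm (x k.+1 - x k).
  rewrite enorm_gt0 subr_eq0 (hpg_step1 x_hpg k1) eq_sym.
  by apply/eqP; exact: (hpg_no_stop x_hpg).
split; first by have := mulr_gt0 a2 (exprn_gt0 2 dn); lra.
move=> xr.
have xr' : enorm (x k.+1 - xs) < rad.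
  have := ler_enorm_dist (x k) (x k.+1) xs; lra.
have xr1 : enorm (x k - xs) < rad by lra.
have gC := hC k k1 Sk sgk xr1 xr'.
apply: (@le_trans _ _ (hpg_alpha P / 2 / C * (enorm (x k.+1 - x k) * enorm (g (x k))))).
  by rewrite ler_wpM2r// ge_min lexx orbT.
apply: (@le_trans _ _ (hpg_alpha P / 2 * enorm (x k.+1 - x k) ^+ 2)); last by lra.
rewrite -mulrA ler_wpM2l ?(ltW a2)// ler_pdivrMl// expr2.
rewrite [leRHS]mulrCA ler_wpM2l ?enorm_ge0.
Unshelve. all: by end_near. Qed.

Hypothesis f_hess_lip : locally_lipschitz (hess f).
Hypothesis F_KL : KL_function (fun z => (objF f A lam q z)%:E).

Lemma iterates_converge : exists xs : 'cV[R]_n,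
  (forall e, 0 < e -> \forall k \near \oo, enorm (x k - xs) < e) /\
  \forall k \near \oo, supp (x k) = supp xs.
Proof.
have /andP[q0 q1] := q_range.
have [S [nu [nu0 hstab]]] :=
  support_stabilizes.
have [E [r [E0 hr]]] := level_set_bounded A lam_gt0 q_range f_lb (F (x 0%N)).
have xr k : enorm (x k) <= r.
  by have [] := hr (x k) (objF_le0 k).
have [xs hxs] := bounded_ex_cluster xr.
have [N0 _ hN0] := hstab.
have xsS : supp xs = S.
  apply/setP => i; rewrite inE.
  have [iS|iS] := boolP (i \in S).
    have [k Nk xk] := hxs nu N0 nu0.
    have [_ /(_ i iS) h _] := hN0 k Nk.
    apply: contraTneq xk => xi; rewrite -leNgt; apply: le_trans h _.
    by have := coord_le_enorm (x k - xs) i; rewrite !mxE xi subr0.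
  apply/negbTE; rewrite negbK -normr_le0; apply/ler_addgt0Pr => e e0; rewrite add0r.
  have [k Nk xk] := hxs e N0 e0.
  have [Sk _ _] := hN0 k Nk.
  have xki : x k i 0 = 0 by apply: supp0; rewrite Sk.
  have := coord_le_enorm (x k - xs) i; rewrite !mxE xki sub0r normrN.
  by move=> /le_trans; apply; exact: ltW.
have hS : \forall k \near \oo, supp (x k) = supp xs /\
    forall i, Num.sg (x k.+1 i 0) = Num.sg (x k i 0).
  by apply: filterS hstab => k [-> _ ?]; rewrite xsS.
exists xs; split; last by apply: filterS hS => k [].
have [Fs FsF Fcvg] := objF_cvg.
have FsE : F xs = Fs.
  have us0 : forall i, subvec (supp xs) xs i 0 != 0 by exact: subvec_supp_neq0.
  have [rad [L [sm _]]] := ex_smooth_ball (subcols (supp xs) A) lam f_C2 f_hess_lip (ltW q1) us0.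
  have rad0 := sb_rho sm; have L0 := sb_L sm.
  have [N1 _ hN1] := hS.
  set us := subvec _ _ in us0 sm.
  have FE k : (N1 <= k)%N -> enorm (x k - xs) <= rad -> enorm (x k - xs) <= 1 ->
      `|F (x k) - F xs| <= (enorm (grad (FS (supp xs)) us) + L) * enorm (x k - xs).
    move=> Nk xk x1; have [Sk _] := hN1 k Nk.
    rewrite (@objF_subvec _ _ _ _ _ _ _ (supp xs) (x k)) ?gt_eqF//; last first.
      by move=> i; rewrite -Sk; exact: supp0.
    rewrite (@objF_subvec _ _ _ _ _ _ _ (supp xs) xs) ?gt_eqF//; last exact: supp0.
    have dE : enorm (subvec (supp xs) (x k) - us) = enorm (x k - xs).
      rewrite -subvecB enorm_subvec// => i iS.
      by rewrite !mxE !supp0 ?Sk// subrr.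
    have b0 : enorm (us - us) <= rad by rewrite subrr enorm0 ltW.
    have := sb_taylor1 sm b0 (w := subvec (supp xs) (x k)).
    rewrite dE => /(_ xk) h1.
    have h2 := cauchy_schwarz (grad (FS (supp xs)) us) (subvec (supp xs) (x k) - us).
    rewrite dE in h2.
    set D := dot _ _ in h1 h2; set e := enorm (x k - xs) in h1 h2 xk x1 *.
    rewrite -[X in `|X| <= _](subrK D); apply: le_trans (ler_normD _ _) _.
    rewrite addrC mulrDl lerD//; apply: le_trans h1 _.
    by rewrite expr2 ler_wpM2l// ler_piMr// enorm_ge0.
  apply/eqP; rewrite eq_le; apply/andP; split; apply/ler_addgt0Pr => e e0.
    have e2 : 0 < e / 2 by rewrite divr_gt0.
    have [e1 e10 he1] := ex_small_mul (enorm (grad (FS (supp xs)) us) + L) e2.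
    have [N2 _ hN2] := Fcvg _ e2.
    have mn : 0 < Num.min rad (Num.min 1 e1) by rewrite !lt_min rad0 ltr01.
    have [k Nk] := hxs _ (maxn N1 N2) mn; rewrite !lt_min => /andP[k1 /andP[k2 k3]].
    have := FE k (leq_trans (leq_maxl _ _) Nk) (ltW k1) (ltW k2).
    have := he1 (enorm (x k - xs)); rewrite enorm_ge0 (ltW k3) => /(_ isT) h1.
    rewrite ler_norml => /andP[h2 _].
    have := hN2 k (leq_trans (leq_maxr _ _) Nk) => /= h3; lra.
  have [e1 e10 he1] := ex_small_mul (enorm (grad (FS (supp xs)) us) + L) e0.
  have mn : 0 < Num.min rad (Num.min 1 e1) by rewrite !lt_min rad0 ltr01.
  have [k Nk] := hxs _ N1 mn; rewrite !lt_min => /andP[k1 /andP[k2 k3]].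
  have := FE k Nk (ltW k1) (ltW k2).
  have := he1 (enorm (x k - xs)); rewrite enorm_ge0 (ltW k3) => /(_ isT) h1.
  by rewrite ler_norml => /andP[_ h2]; have := FsF k; lra.
have [rad [c [rad0 c0 hdec]]] := step_decrease hS.
have [eta [rad' [phi [eta0 rad'0 phi0 phic hKL]]]] :=
  KL_descent f_C2 lam_gt0 q_range xs F_KL.
move=> e e0; pose e1 := Num.min e (Num.min rad rad').
have e10 : 0 < e1 by rewrite !lt_min e0 rad0.
have ce : 0 < c * (e1 / 2) by rewrite mulr_gt0// divr_gt0.
have [del del0 hdel] := phic _ ce.
have mde : 0 < Num.min del eta by rewrite lt_min del0.
have [N _ hN] : \forall k \near \oo, [/\ F (x k.+1) < F (x k), enorm (x k - xs) < rad ->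
    c * (enorm (x k.+1 - x k) * enorm (g (x k))) <= F (x k) - F (x k.+1)
    & F (x k) < Fs + Num.min del eta].
  near=> k.
  have Fk : F (x k) < Fs + Num.min del eta by near: k; exact: Fcvg.
  by split => //; near: k; apply: filterS hdec => k [].
have e12 : 0 < e1 / 2 by rewrite divr_gt0.
have [K NK xK] := hxs _ N e12.
have gap k : (N <= k)%N -> 0 < F (x k) - F xs < Num.min del eta.
  move=> Nk; have [h1 _ h2] := hN k Nk; have h3 := FsF k.+1.
  rewrite FsE; apply/andP; split; lra.
have phige k : (N <= k)%N -> 0 <= phi (F (x k) - F xs).
  move=> Nk; have /andP[h1 h2] := gap k Nk; apply: phi0.
  by rewrite ltW//= (lt_le_trans h2)// ge_min lexx orbT.
have capture j : c * enorm (x (K + j)%N - x K) + phi (F (x (K + j)%N) - F xs)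
    <= phi (F (x K) - F xs) /\ enorm (x (K + j)%N - xs) < e1.
  elim: j => [|j [IH IHe]].
    rewrite addn0 subrr enorm0 mulr0 add0r; split => //.
    by apply: lt_trans xK _; lra.
  rewrite addnS; set k := (K + j)%N in IH IHe *.
  have Nk : (N <= k)%N by rewrite (leq_trans NK) ?leq_addr.
  have [h1 h2 _] := hN k Nk.
  have kr : enorm (x k - xs) < rad.
    by apply: lt_le_trans IHe _; rewrite !ge_min lexx orbT.
  have kr' : enorm (x k - xs) < rad'.
    by apply: lt_le_trans IHe _; rewrite !ge_min lexx !orbT.
  have {}h2 := h2 kr.
  have /andP[g1 g2] := gap k Nk; have /andP[g3 _] := gap k.+1 (leqW Nk).
  have ge : F (x k) - F xs < eta by rewrite (lt_le_trans g2)// ge_min lexx orbT.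
  have := hKL (x k) (F (x k.+1) - F xs) kr'.
  rewrite g1 ge (ltW g3) lerD2r (ltW h1) => /(_ isT isT).
  set p1 := phi _; set p2 := phi _ => h3.
  have G0 := enorm_ge0 (g (x k)).
  have h4 : 0 < (p1 - p2) * enorm (g (x k)) by apply: lt_le_trans h3; lra.
  have Gp : 0 < enorm (g (x k)).
    by rewrite lt_def G0 andbT; apply: contraTneq h4 => ->; rewrite mulr0 ltxx.
  have h5 : c * enorm (x k.+1 - x k) <= p1 - p2.
    rewrite -(ler_pM2r Gp) -mulrA; apply: le_trans h2 _; lra.
  have h6 := ler_wpM2l (ltW c0) (ler_enorm_dist (x k) (x k.+1) (x K)).
  have h7 : c * enorm (x k.+1 - x K) + p2 <= phi (F (x K) - F xs).
    by rewrite mulrDr in h6; rewrite -/p1 in IH; lra.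
  split => //.
  have p20 : 0 <= p2 by exact: phige (leqW Nk).
  have pK : phi (F (x K) - F xs) < c * (e1 / 2).
    have /andP[a1 a2] := gap K NK.
    by apply: hdel; rewrite ltW//= (lt_le_trans a2)// ge_min lexx.
  have h8 : enorm (x k.+1 - x K) < e1 / 2 by rewrite -(ltr_pM2l c0); lra.
  have := ler_enorm_dist (x K) (x k.+1) xs; lra.
exists K => // k /= Kk; have [_] := capture (k - K)%N; rewrite subnKC//.
by move=> /lt_le_trans; apply; rewrite ge_min lexx.
Unshelve. all: by end_near. Qed.

(* By the prox threshold the curvature term of xb^k is at most q/2 times mub_k, so
   the second part of the test holds with slack once x^k and xb^k are close. *)
Lemma newton_test_eventually : \forall k \near \oo, K2 k.
Proof.
have /andP[q0 q1] := q_range.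
have [S [nu [nu0 hstab]]] :=
  support_stabilizes.
have nu5 : 0 < nu / 5 by rewrite divr_gt0.
near=> k; apply: contrapT => k1.
have dx : enorm (x k.+1 - x k) < nu / 5.
  by near: k; exact: step_cvg0 nu5.
have [Sk lbk sgk] : [/\ supp (x k) = S, forall i, i \in S -> nu <= `|x k i 0|
    & forall i, Num.sg (x k.+1 i 0) = Num.sg (x k i 0)] by near: k.
have xE := hpg_step1 x_hpg k1.
have hsg i : Num.sg (x k i 0) = Num.sg (xb k i 0) by rewrite -xE sgk.
apply: k1; split => //=.
have [xk0 xbk0] := same_sign_neq0 hsg.
have [j jS [Ej _]] := absmin_attained xk0.
have [l lS [El lmin]] := absmin_attained xbk0.
have jS' : j \in supp (xb k) 
  by move: jS; rewrite !inE -!(sgr_eq0 (_ j 0)) hsg.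
have xj : nu <= `|x k j 0| by apply: lbk; rewrite -Sk.
have lj : absmin (xb k) <= 6 / 5 * absmin (x k).
  apply: le_trans (lmin j jS') _; rewrite Ej.
  have := coord_le_enorm (x k.+1 - x k) j; rewrite !mxE xE => h.
  rewrite xE in dx.
  have := ler_normD (x k j 0) (xb k j 0 - x k j 0); rewrite subrKC; lra.
have thr := xb_threshold (k := k) (i := l).
rewrite inE in lS; have {thr} := thr lS; rewrite -El => thr.
have M0 : 0 < absmin (xb k) by rewrite El normr_gt0.
have mk0 := mub_gt0 k.
have q20 : q - 2 <= 0 by lra.
have p56 : (0 : R) < 5 / 6 by lra.
have hT : absmin (x k) `^ (q - 2) <= 36 / 25 * absmin (xb k) `^ (q - 2).
  apply: (@le_trans _ _ ((5 / 6 * absmin (xb k)) `^ (q - 2))).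
    by apply: le_powR_npos => //; [rewrite mulr_gt0|lra].
  rewrite powRM ?(ltW p56) ?(ltW M0)// ler_wpM2r ?powR_ge0//.
  apply: (@le_trans _ _ ((5 / 6) `^ (- 2%:R))).
    by apply: ger_powR; [apply/andP; split; lra|lra].
  by rewrite powR_invn ?(ltW p56)//; lra.
move: hT thr; set T := absmin (xb k) `^ _; set T' := absmin (x k) `^ _.
move=> hT thr.
have c0 : 0 < lam * (1 - q) by rewrite mulr_gt0// subr_gt0.
have T0 : 0 <= T by exact: powR_ge0.
have h1 : q * (lam * (1 - q) * T) <= lam * (1 - q) * T.
  by apply: ler_piMl; [rewrite mulr_ge0// ltW|exact: ltW].
have qc0 : 0 < q * (lam * (1 - q)) by rewrite mulr_gt0.
have h2 := ler_wpM2l (ltW qc0) hT.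
lra.
Unshelve. all: by end_near. Qed.

Lemma newton_step_supp (S : {set 'I_n}) z p z' (u := subvec S z)
    (r := grad (FS S) u) (dS := subvec S p) :
  supp z = S -> newton_step f A lam q P z p z' ->
  (hess (FS S) u + (hpg_b1 P * Num.max (- lambda_min (hess (FS S) u)) 0 +
     hpg_b2 P * enorm r `^ hpg_sigma P)%:M) *m dS = - r /\
  exists mk : nat,
    [/\ FS S (u + hpg_beta P ^+ mk *: dS) <=
          FS S u + hpg_rho P * hpg_beta P ^+ mk * dot r dS,
        forall j, (j < mk)%N -> ~~ (FS S (u + hpg_beta P ^+ j *: dS) <=
          FS S u + hpg_rho P * hpg_beta P ^+ j * dot r dS)
      & subvec S z' = u + hpg_beta P ^+ mk *: dS].
Proof.
rewrite /dS /r /u => <- [E _ [mk [h1 h2 h3]]]; split; first exact: E.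
exists mk; split; [exact: h1|exact: h2|].
by rewrite h3 subvecD subvecZ.
Qed.

Lemma error_bound_witness (S : {set 'I_n}) (u : 'cV[R]_#|S|) kappa : 0 < kappa ->
  (kappa%:E * dist u (second_order_points f A lam q S)
    <= (enorm (grad (FS S) u))%:E)%E ->
  grad (FS S) u != 0 ->
  exists v, [/\ grad (FS S) v = 0, psd (hess (FS S) v)
    & enorm (u - v) <= 2 / kappa * enorm (grad (FS S) u)].
Proof.
move=> k0 hk; rewrite -enorm_gt0; set G := enorm _ in hk * => G0.
have : (dist u (second_order_points f A lam q S) < (2 / kappa * G)%:E)%E.
  rewrite ltNge; apply/negP => h.
  have := le_trans (lee_wpmul2l _ h) hk; rewrite lee_fin (ltW k0) => /(_ isT).
  rewrite -EFinM lee_fin (_ : kappa * _ = 2 * G); first lra.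
  by field; rewrite gt_eqF.
move=> /ereal_inf_lt[_ [v [_ v0 vpsd] <-]]; rewrite lte_fin => /ltW h.
by exists v.
Qed.

End Run.

Theorem theorem4p9 (R : realType) (m n : nat) (A : 'M[R]_(m, n))
    (f : 'cV[R]_m -> R) (lam q : R) (P : hpg_param R)
    (x xb d : nat -> 'cV[R]_n) (mu mub : nat -> R)
    (f_C2 : twice_continuously_differentiable f)
    (f_bounded_below : has_lbound (range f))
    (lam_gt0 : 0 < lam)
    (q_range : 0 < q < 1)
    (P_valid : hpg_param_valid P)
    (x_hpg : HpgSRN f A lam q P x xb d mu mub)
    (f_hess_lip : locally_lipschitz (hess f))
    (ratio_liminf :
      (0 < limf_einf (fun k => (descent_ratio f A lam q (x k) (d k))%:E)
             (within (K2 lam q x xb mub) \oo))%E)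
    (F_KL : KL_function (fun z => (objF f A lam q z)%:E)) :
  exists xstar : 'cV[R]_n,
    x @ \oo --> xstar /\
    (let S := supp xstar in
     let FS := objFS f A lam q S in
     let ustar := subvec S xstar in
     psd (hess FS ustar) ->
     (exists delta kappa1 : R,
        [/\ 0 < delta, 0 < kappa1 &
            forall u : 'cV[R]_#|S|, enorm (u - ustar) <= delta ->
              (forall i, u i 0 != 0) /\
              (kappa1%:E * dist u (second_order_points f A lam q S)
                 <= (enorm (grad FS u))%:E)%E]) ->
     (fun k => enorm (x k.+1 - xstar))
       =O_\oo (fun k => enorm (x k - xstar) `^ (1 + hpg_sigma P))).
Proof.
have [xs [xcvg xsupp]] := iterates_converge f_C2 f_bounded_below lam_gt0 q_range
  P_valid x_hpg ratio_liminf f_hess_lip F_KL.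
exists xs; split; first exact/cvg_enormP.
move=> S FS ustar _ [delta [kappa [delta0 kappa0 hloc]]].
have /andP[q0 q1] := q_range.
have /andP[sg0 sg12] := hpg_sigma_range P_valid.
have us0 : forall i, ustar i 0 != 0 by exact: subvec_supp_neq0.
have [rad [L [sm _]]] :=
  ex_smooth_ball (subcols S A) lam f_C2 f_hess_lip (ltW q1) us0.
have sg1 : hpg_sigma P < 1 by lra.
have k20 : 0 <= 2 / kappa by rewrite divr_ge0// ltW.
have distE k : supp (x k) = S -> enorm (subvec S (x k) - ustar) = enorm (x k - xs).
  move=> Sk; rewrite -subvecB enorm_subvec// => i iS.
  by rewrite !mxE !supp0 ?Sk// subrr.
have hnewton : \forall k \near \oo, supp (x k) = S /\
    newton_step f A lam q P (x k) (d k) (x k.+1) /\ K2 lam q x xb mub k.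
  have h2 := newton_test_eventually f_C2 f_bounded_below lam_gt0 q_range P_valid
    x_hpg ratio_liminf.
  apply: filterS2 xsupp h2 => k Sk k2.
  by split=> //; split=> //; exact: (hpg_step2 x_hpg).
have [c _ hratio] := ratio_near f_C2 q_range P_valid x_hpg ratio_liminf.
have [C hC] : exists C : R, \forall k \near \oo,
    enorm (subvec S (x k.+1) - ustar) <=
    C * enorm (subvec S (x k) - ustar) `^ (1 + hpg_sigma P).
  apply: (@local_newton_rate R #|S| FS ustar rad L (hpg_sigma P) (hpg_rho P)
    (hpg_beta P) (hpg_b1 P) (hpg_b2 P) sm sg0 sg1 (hpg_rho_range P_valid)
    (hpg_beta_range P_valid) (hpg_b1_gt1 P_valid) (hpg_b2_gt0 P_valid)
    (fun k => subvec S (x k)) (fun k => subvec S (d k)) _ _ _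
    delta (2 / kappa) delta0 k20).
  - move=> e e0; near=> k; rewrite distE; last by near: k.
    by near: k; exact: xcvg.
  - by apply: filterS hnewton => k [Sk [/(newton_step_supp Sk)[]]].
  - by apply: filterS hnewton => k [Sk [/(newton_step_supp Sk)[_]]].
  - move=> w hw g0; have [_ hk] := hloc w hw.
    exact: (error_bound_witness kappa0 hk g0).
  - apply: filterS2 hnewton hratio => k [Sk [_ k2]].
    move=> /(_ k2)[r0 _ _]; move: r0; rewrite enorm_gt0.
    by rewrite /FS -Sk.
apply/eqO_exP; exists (`|C| + 1); first by rewrite ltr_wpDl.
apply: filterS3 xsupp (near_succ xsupp) hC => k Sk Sk1 /=.
rewrite (distE _ Sk) (distE _ Sk1) => h.
rewrite (ger0_norm (enorm_ge0 _)) (ger0_norm (powR_ge0 _ _)).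
apply: le_trans h _.
by rewrite ler_wpM2r ?powR_ge0// (le_trans (ler_norm C))// lerDl.
Unshelve. all: by end_near. Qed.
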